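(* Let $X$ be a normed linear space, $Y$ a Banach space, and $k\in\mathbb N\cup\{\infty\}$ such that the pair $(X,Y)$ has properties (LE) and (LA$_1$), both with the same constant $C\ge1$, and moreover it has property (LA$_k$). Let $\Omega\subset X$ be an open connected set and let $A\subset\Omega$ be relatively closed (in $\Omega$). Suppose that $f\colon A\to Y$ is $L$-Lipschitz and satisfies condition (W) with $G\colon A\to\mathcal L(X;Y)$ such that $\sup_{x\in A}\|G(x)\|\le L$. Then $f$ can be extended to a $17C^3L$-Lipschitz mapping $g\in C^1(\Omega;Y)$ such that $Dg=G$ on $A$ and $g$ is $C^k$-smooth on $\Omega\setminus A$.
   Context: All normed linear spaces are real. $U(x,r)$ is the open ball with centre $x$ and radius $r$, $U_X$ is the open unit ball of $X$. An $L$-Lipschitz mapping is a mapping with a (not necessarily minimal) Lipschitz constant $L$. $\mathcal L(X;Y)$ is the normed space of continuous linear operators from $X$ to $Y$. $Dg$ is the Fréchet derivative. For open $\Omega\subset X$, $C^k(\Omega;Y)$ is the space of $C^k$-smooth (in the Fréchet sense) mappings from $\Omega$ to $Y$. Condition (W): a mapping $f\colon A\to Y$, $A\subset X$, satisfies condition (W) with $G$ if $G\colon A\to\mathcal L(X;Y)$ is continuous and for each $x\in A$ the operator $G(x)$ is a strict derivative of $f$ at $x$ with respect to $A$, i.e. for each $\varepsilon>0$ there is $\delta>0$ such that $\|f(z)-f(y)-G(x)[z-y]\|\le\varepsilon\|z-y\|$ whenever $y,z\in U(x,\delta)\cap A$. Property (LE) with $C$: the pair $(X,Y)$ of normed linear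 spaces has property (LE) with $C>0$ if for every $A\subset X$ every $L$-Lipschitz mapping $f\colon A\to Y$ has a $CL$-Lipschitz extension to the whole of $X$. Property (LA$_k$), $k\in\mathbb N\cup\{\infty\}$: the pair $(X,Y)$ of normed linear spaces has property (LA$_k$) with $C\ge0$ if for any $L$-Lipschitz mapping $f\colon U_X\to Y$ and any $\varepsilon>0$ there is a $CL$-Lipschitz mapping $g\in C^k(U_X;Y)$ such that $\sup_{U_X}\|f-g\|\le\varepsilon$. It has property (LA$_k$) if it has it with some $C\ge0$. *)

(* Defs.v *)
From HB Require Import structures.
From mathcomp Require Import all_boot all_order all_algebra.
From mathcomp Require Import all_classical all_reals all_analysis.

Set Implicit Arguments.
Unset Strict Implicit.
Unset Printing Implicit Defensive.

Import Order.TTheory GRing.Theory Num.Theory.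
Import numFieldNormedType.Exports.

Local Open Scope classical_set_scope.
Local Open Scope ring_scope.

Section continuous_linear_operators.
Context {R : realType} {X Y : normedModType R}.

Definition continuous_linear : {pred X -> Y} :=
  [pred T : X -> Y | `[< linear T /\ continuous T >]].

Lemma continuous_linearP (T : X -> Y) :
  reflect (linear T /\ continuous T) (T \in continuous_linear).
Proof. exact: asboolP. Qed.

Lemma continuous_linear_submod : submod_closed continuous_linear.
Proof.
split.
  apply/continuous_linearP; split.
    by move=> a u v /=; rewrite scaler0 addr0.
  by move=> x; exact: cvg_cst.
move=> a S T /continuous_linearP[linS ctS] /continuous_linearP[linT ctT].
apply/continuous_linearP; split.
  move=> b u v /=; rewrite !fctE linS linT.
  rewrite !scalerDr !scalerA (mulrC a b) -!addrA; congr (_ + _).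
  by rewrite addrCA.
move=> x; by apply: cvgD; [apply: cvgZl_tmp; exact: ctS | exact: ctT].
Qed.

HB.instance Definition _ := GRing.isSubmodClosed.Build R (X -> Y)
  continuous_linear continuous_linear_submod.

End continuous_linear_operators.

Record clin (R : realType) (X Y : normedModType R) := CLin {
  clin_fun :> X -> Y ;
  clin_prop : clin_fun \in continuous_linear }.
Arguments clin_fun {R X Y}.
Arguments CLin {R X Y}.

Notation "''L' ( X , Y )" := (clin X Y)
  (at level 8, format "''L' ( X ,  Y )") : type_scope.

HB.instance Definition _ (R : realType) (X Y : normedModType R) :=
  [isSub for @clin_fun R X Y].
HB.instance Definition _ (R : realType) (X Y : normedModType R) :=
  [Choice of 'L(X, Y) by <:].
HB.instance Definition _ (R : realType) (X Y : normedModType R) :=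
  [SubChoice_isSubLmodule of 'L(X, Y) by <:].

Section clin_theory.
Context {R : realType} {X Y : normedModType R}.
Implicit Types S T : 'L(X, Y).

Lemma clin_is_linear T : linear T.
Proof. by have /continuous_linearP[] := clin_prop T. Qed.

HB.instance Definition _ T :=
  GRing.isLinear.Build R X Y *:%R (T : X -> Y) (clin_is_linear T).

Lemma clin_continuous T : continuous T.
Proof. by have /continuous_linearP[] := clin_prop T. Qed.

Definition opnorm T : R := sup [set `|T x| | x in [set x : X | `|x| <= 1]].

Lemma opnorm_has_sup T : has_sup [set `|T x| | x in [set x : X | `|x| <= 1]].
Proof.
split; first by exists `|T 0|; exists 0 => //=; rewrite normr0 ler01.
have [k k0 Tk] := linear_lipschitz (@clin_continuous T).
exists k => _ [x /= x1 <-]; apply: le_trans (Tk x) _.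
by rewrite -[leRHS]mulr1 ler_wpM2l// ltW.
Qed.

Lemma opnorm_ub T x : `|x| <= 1 -> `|T x| <= opnorm T.
Proof.
by move=> x1; apply: ub_le_sup; [exact: (opnorm_has_sup T).2 | exists x].
Qed.

Lemma opnorm_lub T c : (forall x, `|x| <= 1 -> `|T x| <= c) -> opnorm T <= c.
Proof.
move=> Tc; apply: ge_sup; first exact: (opnorm_has_sup T).1.
by move=> _ [x /= x1 <-]; exact: Tc.
Qed.

Lemma le_opnorm T x : `|T x| <= opnorm T * `|x|.
Proof.
have [->|x0] := eqVneq x 0; first by rewrite linear0 !normr0 mulr0.
have nx0 : 0 < `|x| by rewrite normr_gt0.
rewrite -ler_pdivrMr//.
have := @opnorm_ub T (`|x|^-1 *: x).
rewrite linearZ/= !normrZ normfV normr_id mulVf ?gt_eqF// mulrC.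
by apply.
Qed.

Let opnormD S T : opnorm (S + T) <= opnorm S + opnorm T.
Proof.
apply: opnorm_lub => x x1; apply: le_trans (ler_normD (S x) (T x)) _.
by rewrite lerD// opnorm_ub.
Qed.

Let opnormZ_le (a : R) T : opnorm (a *: T) <= `|a| * opnorm T.
Proof.
apply: opnorm_lub => x x1; rewrite [leLHS](normrZ a (T x)).
by rewrite ler_wpM2l// opnorm_ub.
Qed.

Let opnormZ (a : R) T : opnorm (a *: T) = `|a| * opnorm T.
Proof.
apply/eqP; rewrite eq_le opnormZ_le/=.
have [->|a0] := eqVneq a 0.
  rewrite normr0 mul0r; apply: le_trans (opnorm_ub (0 *: T) (x := 0) _) => //.
  by rewrite normr0 ler01.
rewrite -ler_pdivlMl ?normr_gt0// -normfV.
by have := opnormZ_le a^-1 (a *: T); rewrite scalerA mulVf// scale1r.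
Qed.

Let opnorm0_eq0 T : opnorm T = 0 -> T = 0.
Proof.
move=> T0; apply/val_inj/funext => x; apply/eqP; rewrite -normr_le0.
by apply: le_trans (le_opnorm T x) _; rewrite T0 mul0r.
Qed.

HB.instance Definition _ := Lmodule_isNormed.Build R 'L(X, Y)
  opnormD opnormZ opnorm0_eq0.

Lemma clin_normE T : `|T| = opnorm T. Proof. by []. Qed.

End clin_theory.

Section smoothness.
Context {R : realType} {X : normedModType R}.

(* The value is meaningful only at points where [f] is differentiable. *)
Definition frechet {Y : normedModType R} (f : X -> Y) (x : X) : 'L(X, Y) :=
  insubd 0 ('d f x : X -> Y).

Lemma frechetE {Y : normedModType R} (f : X -> Y) (x : X) :
  differentiable f x -> frechet f x = 'd f x :> (X -> Y).
Proof.
move=> df; rewrite /frechet -[LHS]/(val _) insubdK//.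
apply/continuous_linearP; split; first exact: linearP.
exact: diff_continuous.
Qed.

(* Smoothness on an open set [U]; the values of [f] off [U] are irrelevant. *)
Fixpoint Cfin (n : nat) {Y : normedModType R} (U : set X) (f : X -> Y) : Prop :=
  if n is m.+1 then
    (forall x, U x -> differentiable f x) /\ Cfin m U (frechet f)
  else {within U, continuous f}.

(* [None] stands for k = oo. *)
Definition Csmooth (k : option nat) {Y : normedModType R} (U : set X)
    (f : X -> Y) : Prop :=
  if k is Some n then Cfin n U f else forall n, Cfin n U f.

End smoothness.

(* Maps defined on a subset [A] of [X] are represented by total maps, of which
   only the values on [A] matter. *)
Section properties.
Context {R : realType} {X Y : normedModType R}.

Definition relatively_closed (Omega A : set X) : Prop :=
  exists2 F : set X, closed F & A = Omega `&` F.

Definition strict_derivative (A : set X) (f : X -> Y) (x : X) (T : 'L(X, Y)) :=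
  forall e : R, 0 < e -> exists2 d : R, 0 < d &
    forall y z, (ball x d `&` A) y -> (ball x d `&` A) z ->
      `|f z - f y - T (z - y)| <= e * `|z - y|.

Definition condition_W (A : set X) (f : X -> Y) (G : X -> 'L(X, Y)) : Prop :=
  {within A, continuous G} /\ forall x, A x -> strict_derivative A f x (G x).

End properties.

(* Lipschitz constants are required to be nonnegative: a negative one would be
   vacuously admissible on a singleton. *)
Definition property_LE (R : realType) (X Y : normedModType R) (C : R) : Prop :=
  0 < C /\
  forall (A : set X) (L : R) (f : X -> Y), 0 <= L -> L.-lipschitz_A f ->
    exists2 g : X -> Y, (C * L).-lipschitz g & forall x, A x -> g x = f x.

Definition property_LA_with (R : realType) (X Y : normedModType R)
    (k : option nat) (C : R) : Prop :=
  0 <= C /\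
  forall (L : R) (f : X -> Y), 0 <= L -> L.-lipschitz_(ball (0 : X) 1) f ->
    forall e : R, 0 < e ->
    exists g : X -> Y, [/\ (C * L).-lipschitz_(ball (0 : X) 1) g,
      Csmooth k (ball (0 : X) 1) g &
      forall x, ball (0 : X) 1 x -> `|f x - g x| <= e].

Definition property_LA (R : realType) (X Y : normedModType R)
    (k : option nat) : Prop :=
  exists C : R, property_LA_with X Y k C.

(* Main.v *)
Require Import Defs.
From HB Require Import structures.
From mathcomp Require Import all_boot all_order all_algebra.
From mathcomp Require Import all_classical all_reals all_analysis.
From mathcomp Require Import ring lra.

Set Implicit Arguments.
Unset Strict Implicit.
Unset Printing Implicit Defensive.

Import Order.TTheory GRing.Theory Num.Theory.
Import numFieldNormedType.Exports.

Local Open Scope classical_set_scope.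
Local Open Scope ring_scope.

(** Near each point a of A the remainder f - G(a) is e-Lipschitz on A, so (LE)
    extends it with a small constant. Pasting such extensions with Lipschitz
    partition functions (given by a Stone-type sigma-discrete refinement, the
    bumps coming from (LA) composed with a functional on Y and a real step
    function) and using (LE) once more gives a Lipschitz extension F of f
    for which F - G(a) has local Lipschitz constant e at every a in A. A fine
    C^1 approximation h of F then leaves a remainder f - h that again satisfies
    (W), now with constant e in place of L. Summing the approximations h_n of
    the successive remainders, whose constants are L / 2^n, gives a C^1
    extension, which is finally replaced off A by a C^1-fine C^k approximation.
    Lipschitz constants are controlled on the non-convex set Omega because all
    errors are dominated by the distance to its complement. *)

(** Property (LA) bounds the error and the Lipschitz constant of an approximant but says nothing
    about its derivative. Derivatives are therefore controlled through the predicate [slip]: where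
    [F - T] has a small Lipschitz constant, with [T] linear, (LA) is applied to [F - T], and adding
    [T] back gives a smooth map whose derivative is close to [T].

    The partition functions have Lipschitz constants that grow with their index. The pieces are thus
    glued by nested convex combinations that terminate near each point, and the [n]-th piece is
    chosen so accurate that its error times the [n]-th constant is summable. For this reason the
    constant of (LA) for real-valued maps, which is inherited from [Y] with a loss, does not enter
    the final bound.

    Origin of the bound: joining two points through [A] gives [5 L], and (LE) and (LA) contribute
    one factor [C] each, so a remainder of size [L] costs [5 C^2 L] up to a small error. Summing
    over halved remainders gives [(10 C^2 + 1) L], smoothing off [A] adds another [L], and
    [10 C^2 + 2 <= 17 C^3]. *)

(* [lmod] proves identities between linear combinations in an [lmodType] by
   comparing coefficients with [ring]. *)
Inductive lin_expr (R : Type) : Type :=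
  | LVar of nat
  | LAdd of lin_expr R & lin_expr R
  | LOpp of lin_expr R
  | LZero
  | LScale of R & lin_expr R.
Arguments LVar {R}.
Arguments LZero {R}.

Section lin_expr.
Context {R : pzRingType} {V : lmodType R}.
Implicit Types (e : lin_expr R) (env : seq V).

Fixpoint lin_eval env e : V :=
  match e with
  | LVar n => nth 0 env n
  | LAdd a b => lin_eval env a + lin_eval env b
  | LOpp a => - lin_eval env a
  | LZero => 0
  | LScale r a => r *: lin_eval env a
  end.

Fixpoint lin_coef e (n : nat) : R :=
  match e with
  | LVar m => if Nat.eqb m n then 1 else 0
  | LAdd a b => lin_coef a n + lin_coef b n
  | LOpp a => - lin_coef a n
  | LZero => 0
  | LScale r a => r * lin_coef a n
  end.

Fixpoint same_lin_coefs n e1 e2 : Prop :=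
  if n is m.+1 then lin_coef e1 m = lin_coef e2 m /\ same_lin_coefs m e1 e2
  else True.

Lemma lin_evalE env e :
  lin_eval env e = \sum_(i < size env) lin_coef e i *: nth 0 env i.
Proof.
elim: e => [m|a IHa b IHb|a IHa||r a IHa] /=.
- have eqbE i : Nat.eqb m i = (m == i) by elim: m i => [|m IH] [|i] //=.
  have [mi|mi] := ltnP m (size env).
    rewrite (bigD1 (Ordinal mi))//= eqbE eqxx scale1r big1 ?addr0// => i im.
    rewrite eqbE; case: eqP => [E|]; last by rewrite scale0r.
    by move/eqP: im; case; apply/val_inj.
  rewrite nth_default// big1// => i _; rewrite eqbE.
  case: eqP => [E|]; last by rewrite scale0r.
  by move: (ltn_ord i); rewrite -E ltnNge mi.
- rewrite IHa IHb -big_split/=; apply: eq_bigr => i _; exact/esym/scalerDl.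
- by rewrite IHa -sumrN; apply: eq_bigr => i _; rewrite scaleNr.
- by rewrite big1// => i _; rewrite scale0r.
- by rewrite IHa scaler_sumr; apply: eq_bigr => i _; rewrite scalerA.
Qed.

Lemma lin_eval_eq env e1 e2 : same_lin_coefs (size env) e1 e2 ->
  lin_eval env e1 = lin_eval env e2.
Proof.
rewrite !lin_evalE => H; apply: eq_bigr => i _; congr (_ *: _).
elim: (size env) H i => [_ [[]//]|n IH /= [En /IH{}IH] i].
have [<-//|ni] := eqVneq n i.
have ni' : (i < n)%N by rewrite ltn_neqAle eq_sym ni -ltnS ltn_ord.
exact: (IH (Ordinal ni')).
Qed.

End lin_expr.

Ltac lmod_index x l :=
  lazymatch l with
  | x :: _ => constr:(0%N)
  | _ :: ?l' => let n := lmod_index x l' in constr:(S n)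
  end.

Ltac lmod_has x l :=
  lazymatch l with
  | x :: _ => constr:(true)
  | _ :: ?l' => lmod_has x l'
  | _ => constr:(false)
  end.

Ltac lmod_atoms t l :=
  lazymatch t with
  | (?a + ?b)%R => let l1 := lmod_atoms a l in lmod_atoms b l1
  | (- ?a)%R => lmod_atoms a l
  | (_ *: ?a)%R => lmod_atoms a l
  | 0%R => l
  | _ => match lmod_has t l with true => l | false => constr:(t :: l) end
  end.

Ltac lmod_reify R t l :=
  lazymatch t with
  | (?a + ?b)%R => let x := lmod_reify R a l in let y := lmod_reify R b l in
               constr:(@LAdd R x y)
  | (- ?a)%R => let x := lmod_reify R a l in constr:(@LOpp R x)
  | (?r *: ?a)%R => let x := lmod_reify R a l in constr:(@LScale R r x)
  | 0%R => constr:(@LZero R)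
  | _ => let n := lmod_index t l in constr:(@LVar R n)
  end.

Ltac lmod_in R :=
  cbv beta; lazymatch goal with |- @eq ?V ?a ?b =>
    let l0 := lmod_atoms a (@nil V) in
    let l := lmod_atoms b l0 in
    let x := lmod_reify R a l in
    let y := lmod_reify R b l in
    refine (@lin_eval_eq R _ l x y _);
    cbv beta iota zeta delta [same_lin_coefs lin_coef Nat.eqb size];
    repeat (split; [ring|]); exact I
  end.

Ltac lmod := match goal with r : realType |- _ => lmod_in r end.

(** * Bounded operators and Frechet derivatives *)

Section clin_extra.
Context {R : realType} {X Y : normedModType R}.
Implicit Types S T : 'L(X, Y).

Lemma clin_le T x : `|T x| <= `|T| * `|x|.
Proof. exact: le_opnorm. Qed.

Lemma clin_norm_le T K : 0 <= K -> (forall x, `|T x| <= K * `|x|) -> `|T| <= K.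
Proof.
move=> K0 TK; rewrite clin_normE; apply: opnorm_lub => x x1.
by apply: (le_trans (TK x)); rewrite ler_piMr.
Qed.

Lemma clinB T x y : T (x - y) = T x - T y. Proof. exact: linearB. Qed.
Lemma clinD T x y : T (x + y) = T x + T y. Proof. exact: linearD. Qed.
Lemma clinZ T (a : R) x : T (a *: x) = a *: T x. Proof. exact: linearZ. Qed.
Lemma clin0 T : T 0 = 0. Proof. exact: linear0. Qed.
Lemma clin_addE T S x : (T + S) x = T x + S x. Proof. by []. Qed.
Lemma clin_oppE T x : (- T) x = - T x. Proof. by []. Qed.
Lemma clin_subE T S x : (T - S) x = T x - S x. Proof. by []. Qed.
Lemma clin_scaleE (a : R) T x : (a *: T) x = a *: T x. Proof. by []. Qed.
Lemma clin_zeroE x : (0 : 'L(X, Y)) x = 0. Proof. by []. Qed.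

Lemma clin_eq T S : (forall x, T x = S x) -> T = S.
Proof. by move=> TS; apply/val_inj/funext. Qed.

Lemma linear_bounded_clin (t : X -> Y) (K : R) : linear t ->
  (forall x, `|t x| <= K * `|x|) -> exists S : 'L(X, Y), forall x, S x = t x.
Proof.
move=> lint tK.
have ctst : continuous t.
  pose t' := GRing.isLinear.Build R X Y *:%R t lint.
  pose t'' : {linear X -> Y} := HB.pack t t'.
  apply: (@bounded_linear_continuous _ _ _ t'').
  apply/linear_boundedP; exists K; split; first exact: num_real.
  by move=> r /ltW Kr x; apply: (le_trans (tK x)); rewrite ler_wpM2r.
have tP : t \in @continuous_linear R X Y by apply/continuous_linearP.
by exists (CLin t tP).
Qed.

End clin_extra.

Section has_derivative.
Context {R : realType} {X : normedModType R}.

(** A relational form of the derivative: one statement carries both differentiability and the value,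
    so the default value of [frechet] never interferes. *)
Definition has_frechet {Y : normedModType R} (f : X -> Y) x (T : 'L(X, Y)) :=
  forall e, 0 < e -> exists2 d, 0 < d &
    forall z, `|z - x| < d -> `|f z - f x - T (z - x)| <= e * `|z - x|.

Lemma has_frechetP {Y : normedModType R} (f : X -> Y) x T :
  has_frechet f x T <-> differentiable f x /\ frechet f x = T.
Proof.
have key : f \o shift x = cst (f x) + T +o_ 0 id <-> has_frechet f x T.
  rewrite eqaddoP; split=> [H e e0|H e e0].
    have /nbhs_norm0P[d /= d0 Hd] := H e e0.
    exists d => // z zd; have := Hd _ zd.
    by rewrite /= !fctE/= subrK opprD addrA.
  have [d d0 Hd] := H e e0.
  apply/nbhs_norm0P; exists d => //= z /= zd.
  have := Hd (z + x); rewrite addrK => /(_ zd).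
  by rewrite !fctE/= opprD addrA.
split=> [/key fT|[df Tf]].
  have dfT := diff_unique (@clin_continuous _ _ _ T) fT.
  have df : differentiable f x.
    apply/diff_locallyP; rewrite dfT; split => //.
    exact: clin_continuous.
  by split => //; apply/clin_eq => z; rewrite frechetE// dfT.
apply/key; rewrite -Tf frechetE//; exact: diff_locally.
Qed.

Lemma has_frechet_frechet {Y : normedModType R} (f : X -> Y) x :
  differentiable f x -> has_frechet f x (frechet f x).
Proof. by move=> df; apply/has_frechetP. Qed.

Lemma has_frechet_near_eq {Y : normedModType R} (f g : X -> Y) x T r : 0 < r ->
  (forall z, `|z - x| < r -> f z = g z) -> has_frechet f x T -> has_frechet g x T.
Proof.
move=> r0 fg fT e e0; have [d d0 fd] := fT e e0.
exists (Num.min d r); first by rewrite lt_min d0.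
move=> z; rewrite lt_min => /andP[zd zr].
by rewrite -!fg// ?subrr ?normr0//; exact: fd.
Qed.

Lemma has_frechet_cst {Y : normedModType R} (c : Y) x :
  has_frechet (fun=> c) x 0.
Proof.
move=> e e0; exists 1 => // z _.
by rewrite subrr clin_zeroE subrr normr0 mulr_ge0// ltW.
Qed.

Lemma has_frechetD {Y : normedModType R} (f g : X -> Y) x S T :
  has_frechet f x S -> has_frechet g x T ->
  has_frechet (fun z => f z + g z) x (S + T).
Proof.
move=> fS gT e e0; have e20 : 0 < e / 2 by rewrite divr_gt0.
have [d d0 fd] := fS _ e20; have [r r0 gr] := gT _ e20.
exists (Num.min d r); first by rewrite lt_min d0.
move=> z; rewrite lt_min => /andP[zd zr].
rewrite clin_addE (_ : _ - _ = (f z - f x - S (z - x)) + (g z - g x - T (z - x))).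
  apply: (le_trans (ler_normD _ _)).
  by rewrite [e in leRHS]splitr mulrDl lerD// ?fd ?gr.
by lmod.
Qed.

Lemma has_frechet_lip {Y : normedModType R} (f : X -> Y) x T :
  has_frechet f x T -> exists2 d, 0 < d &
  forall z, `|z - x| < d -> `|f z - f x| <= (`|T| + 1) * `|z - x|.
Proof.
move=> /(_ 1 ltr01)[d d0 fd]; exists d => // z /fd H.
rewrite -[f z - f x](subrK (T (z - x))).
apply: (le_trans (ler_normD _ _)); rewrite mulrDl addrC lerD//.
exact: clin_le.
Qed.

End has_derivative.

(** The composite operator is a parameter [U] with a pointwise description, which avoids a
    composition on ['L(X, Y)]. *)
Lemma has_frechet_comp {R : realType} {X Y Z : normedModType R}
    (f : X -> Y) (g : Y -> Z) x S T (U : 'L(X, Z)) :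
  has_frechet f x S -> has_frechet g (f x) T ->
  (forall z, U z = T (S z)) -> has_frechet (fun z => g (f z)) x U.
Proof.
move=> /has_frechetP[df fS] /has_frechetP[dg gT] UTS.
apply/has_frechetP; split; first exact: (differentiable_comp df dg).
apply: clin_eq => z; rewrite (frechetE (f := g \o f)); last first.
  exact: (differentiable_comp df dg).
rewrite diff_comp//= UTS -gT -fS !frechetE//.
Qed.

(** * Calculus of C^n maps *)

Section finite_smoothness.
Context {R : realType} {X : normedModType R}.
Implicit Types (U V : set X).

Lemma ball_distE (x z : X) r : ball x r z <-> `|z - x| < r.
Proof. by rewrite -ball_normE /= distrC. Qed.

Lemma open_ball_sub U x : open U -> U x ->
  exists2 r, 0 < r & forall z, `|z - x| < r -> U z.
Proof.
move=> oU Ux; have /nbhs_ballP[r /= r0 rU] := open_nbhs_nbhs (conj oU Ux).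
by exists r => // z /ball_distE /rU.
Qed.

Lemma Cfin0P {Y : normedModType R} U (f : X -> Y) : open U ->
  Cfin 0 U f <-> forall x, U x -> forall e, 0 < e ->
    exists2 d, 0 < d & forall z, `|z - x| < d -> `|f z - f x| <= e.
Proof.
move=> oU; rewrite /= continuous_open_subspace//; split=> [cf x Ux e e0|cf x].
  have /cvgrPdist_le/(_ e e0)/nbhs_ballP[d /= d0 Hd] := cf x (mem_set Ux).
  by exists d => // z /ball_distE /Hd /=; rewrite distrC.
move=> /set_mem Ux; apply/cvgrPdist_le => e e0.
have [d d0 Hd] := cf x Ux e e0.
by apply/nbhs_ballP; exists d => //= z /ball_distE /Hd; rewrite distrC.
Qed.

(** The codomain is quantified after [n], here and in the later inductions on the order, because the
    induction hypothesis is applied to the derivative, which takes values in ['L(X, Y)]. *)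
Lemma Cfin_ext n : forall (Y : normedModType R) U (f g : X -> Y), open U ->
  (forall x, U x -> f x = g x) -> Cfin n U f -> Cfin n U g.
Proof.
elim: n => [|n IH] Y U f g oU fg.
  move=> /Cfin0P-/(_ oU) cf; apply/Cfin0P => // x Ux e e0.
  have [d d0 fd] := cf x Ux e e0; have [r r0 rU] := open_ball_sub oU Ux.
  exists (Num.min d r); first by rewrite lt_min d0.
  by move=> z; rewrite lt_min => /andP[zd /rU zr]; rewrite -!fg//; exact: fd.
have H x : U x -> differentiable f x -> has_frechet g x (frechet f x).
  move=> Ux df; have [r r0 rU] := open_ball_sub oU Ux.
  apply: (has_frechet_near_eq r0 _ (has_frechet_frechet df)) => z /rU.
  exact: fg.
move=> [df cf]; split=> [x Ux|]; first by have /has_frechetP[] := H x Ux (df x Ux).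
apply: IH cf => // x Ux.
by have /has_frechetP[_ ->] := H x Ux (df x Ux).
Qed.

Lemma Cfin_sub n : forall (Y : normedModType R) U V (f : X -> Y),
  open U -> open V -> V `<=` U -> Cfin n U f -> Cfin n V f.
Proof.
elim: n => [|n IH] Y U V f oU oV VU.
  by move=> /Cfin0P-/(_ oU) cf; apply/Cfin0P => // x /VU; exact: cf.
by move=> [df cf]; split=> [x /VU/df//|]; exact: IH cf.
Qed.

Lemma Cfin_local n : forall (Y : normedModType R) U (f : X -> Y), open U ->
  (forall x, U x -> exists2 r, 0 < r & Cfin n (ball x r) f) -> Cfin n U f.
Proof.
elim: n => [|n IH] Y U f oU H.
  apply/Cfin0P => // x Ux e e0.
  have [r r0 /Cfin0P] := H x Ux.
  by move=> /(_ (ball_open x r)) /(_ x (ballxx x r0) e e0).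
split=> [x Ux|]; first by have [r r0 [+ _]] := H x Ux; apply; exact: ballxx.
by apply: IH => // x Ux; have [r r0 [_ ?]] := H x Ux; exists r.
Qed.

Lemma CfinS n : forall (Y : normedModType R) U (f : X -> Y), open U ->
  Cfin n.+1 U f -> Cfin n U f.
Proof.
elim: n => [|n IH] Y U f oU.
  move=> [df _]; rewrite /= continuous_open_subspace// => x /set_mem Ux.
  exact: differentiable_continuous (df x Ux).
by move=> [df cf]; split => //; exact: IH.
Qed.

Lemma Cfin_succ n (Y : normedModType R) U (f : X -> Y) (D : X -> 'L(X, Y)) :
  open U -> (forall x, U x -> has_frechet f x (D x)) -> Cfin n U D ->
  Cfin n.+1 U f.
Proof.
move=> oU fD cD; split=> [x /fD/has_frechetP[]//|].
by apply: Cfin_ext cD => // x /fD/has_frechetP[].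
Qed.

Lemma Cfin_cst n : forall (Y : normedModType R) U (c : Y), open U ->
  Cfin n U (fun=> c).
Proof.
elim: n => [|n IH] Y U c oU.
  apply/Cfin0P => // x _ e e0; exists 1 => // z _.
  by rewrite subrr normr0 ltW.
apply: (@Cfin_succ _ _ _ _ (fun=> 0)) => // [x _|]; first exact: has_frechet_cst.
exact: IH.
Qed.

Lemma CfinD n : forall (Y : normedModType R) U (f g : X -> Y), open U ->
  Cfin n U f -> Cfin n U g -> Cfin n U (fun x => f x + g x).
Proof.
elim: n => [|n IH] Y U f g oU.
  move=> /Cfin0P-/(_ oU) cf /Cfin0P-/(_ oU) cg; apply/Cfin0P => // x Ux e e0.
  have e20 : 0 < e / 2 by rewrite divr_gt0.
  have [d d0 fd] := cf x Ux _ e20; have [r r0 gr] := cg x Ux _ e20.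
  exists (Num.min d r); first by rewrite lt_min d0.
  move=> z; rewrite lt_min => /andP[zd zr].
  rewrite (_ : _ - _ = (f z - f x) + (g z - g x)); last by lmod.
  by rewrite (le_trans (ler_normD _ _))// (splitr e) lerD// ?fd ?gr.
move=> [df cf] [dg cg].
apply: (@Cfin_succ _ _ _ _ (fun x => frechet f x + frechet g x)) => //.
  move=> x Ux; apply: has_frechetD; apply: has_frechet_frechet; [exact: df|].
  exact: dg.
exact: IH.
Qed.

Definition bounded_bilinear {Y1 Y2 Z : normedModType R} (B : Y1 -> Y2 -> Z)
    (K : R) :=
  [/\ 0 <= K, forall v, linear (B^~ v), forall u, linear (B u) &
      forall u v, `|B u v| <= K * (`|u| * `|v|)].

Section bilinear.
Context {Y1 Y2 Z : normedModType R} {B : Y1 -> Y2 -> Z} {K : R}.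
Hypothesis bB : bounded_bilinear B K.

Lemma bilinDl u u' v : B (u + u') v = B u v + B u' v.
Proof. by have [_ l _ _] := bB; have := l v 1 u u'; rewrite !scale1r. Qed.
Lemma bilinDr u v v' : B u (v + v') = B u v + B u v'.
Proof. by have [_ _ l _] := bB; have := l u 1 v v'; rewrite !scale1r. Qed.
Lemma bilin0l v : B 0 v = 0.
Proof.
by apply: (addrI (B 0 v)); rewrite -bilinDl !addr0.
Qed.
Lemma bilin0r u : B u 0 = 0.
Proof.
by apply: (addrI (B u 0)); rewrite -bilinDr !addr0.
Qed.
Lemma bilinZl a u v : B (a *: u) v = a *: B u v.
Proof.
by have [_ l _ _] := bB; have := l v a u 0; rewrite bilin0l !addr0.
Qed.
Lemma bilinZr a u v : B u (a *: v) = a *: B u v.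
Proof.
by have [_ _ l _] := bB; have := l u a v 0; rewrite bilin0r !addr0.
Qed.
Lemma bilinNl u v : B (- u) v = - B u v.
Proof. by rewrite -scaleN1r bilinZl scaleN1r. Qed.
Lemma bilinNr u v : B u (- v) = - B u v.
Proof. by rewrite -scaleN1r bilinZr scaleN1r. Qed.

Lemma bilin_le u v a b : `|u| <= a -> `|v| <= b -> `|B u v| <= K * (a * b).
Proof.
move=> ua vb; have [K0 _ _ /(_ u v) H] := bB; apply: (le_trans H).
by rewrite ler_wpM2l// ler_pM.
Qed.

(** The product rule reads [D B(f, g) = B1(Df, g) + B2(f, Dg)]. Since [B1] and [B2] are again
    bounded bilinear, with the same [K], the class of bilinear expressions is closed under
    differentiation, and the induction in [Cfin_bilin] closes. *)
Lemma bilin_derivative : exists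
   B1B2 : ('L(X, Y1) -> Y2 -> 'L(X, Z)) * (Y1 -> 'L(X, Y2) -> 'L(X, Z)),
  [/\ bounded_bilinear B1B2.1 K, bounded_bilinear B1B2.2 K,
      forall S y x, B1B2.1 S y x = B (S x) y &
      forall y S x, B1B2.2 y S x = B y (S x)].
Proof.
have [K0 _ _ BK] := bB.
have /choice[B1 B1E] (Sy : 'L(X, Y1) * Y2) : exists U : 'L(X, Z),
    forall x, U x = B (Sy.1 x) Sy.2.
  apply: (@linear_bounded_clin _ _ _ _ (K * (`|Sy.1| * `|Sy.2|))).
    by move=> a u v; rewrite clinD clinZ bilinDl bilinZl.
  move=> x; apply: (le_trans (BK _ _)); rewrite -mulrA ler_wpM2l//.
  by rewrite mulrAC ler_wpM2r// clin_le.
have /choice[B2 B2E] (Sy : Y1 * 'L(X, Y2)) : exists U : 'L(X, Z),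
    forall x, U x = B Sy.1 (Sy.2 x).
  apply: (@linear_bounded_clin _ _ _ _ (K * (`|Sy.1| * `|Sy.2|))).
    by move=> a u v; rewrite clinD clinZ bilinDr bilinZr.
  move=> x; apply: (le_trans (BK _ _)); rewrite -mulrA ler_wpM2l//.
  by rewrite -mulrA ler_wpM2l// clin_le.
exists (fun S y => B1 (S, y), fun y S => B2 (y, S)); split => //=.
- split => //= [v a S T|S a u v|S y].
  + by apply: clin_eq => x; rewrite clin_addE clin_scaleE !B1E/= bilinDl bilinZl.
  + by apply: clin_eq => x; rewrite clin_addE clin_scaleE !B1E/= bilinDr bilinZr.
  + apply: clin_norm_le => [|x]; first by rewrite !mulr_ge0.
    rewrite B1E/=; apply: (le_trans (BK _ _)); rewrite -mulrA ler_wpM2l//.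
    by rewrite mulrAC ler_wpM2r// clin_le.
- split => //= [S a u v|v a S T|S y].
  + by apply: clin_eq => x; rewrite clin_addE clin_scaleE !B2E/= bilinDl bilinZl.
  + by apply: clin_eq => x; rewrite clin_addE clin_scaleE !B2E/= bilinDr bilinZr.
  + apply: clin_norm_le => [|x]; first by rewrite !mulr_ge0.
    rewrite B2E/=; apply: (le_trans (BK _ _)); rewrite -mulrA ler_wpM2l//.
    by rewrite -mulrA ler_wpM2l// clin_le.
Qed.

Lemma has_frechet_bilin (f : X -> Y1) (g : X -> Y2) x S T (U : 'L(X, Z)) :
  has_frechet f x S -> has_frechet g x T ->
  (forall v, U v = B (S v) (g x) + B (f x) (T v)) ->
  has_frechet (fun z => B (f z) (g z)) x U.
Proof.
move=> fS gT UE e e0; have [K0 _ _ BK] := bB.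
have [d1 d10 f1] := has_frechet_lip fS; have [d2 d20 g1] := has_frechet_lip gT.
(* The three error terms will add up to [(M - 1) / M * (e * h)]. *)
pose M := K * (`|g x| + `|f x| + (`|S| + 1) * (`|T| + 1)) + 1.
have M0 : 0 < M.
  by rewrite ltr_wpDl// mulr_ge0// !addr_ge0// mulr_ge0// addr_ge0.
have eM0 : 0 < e / M by rewrite divr_gt0.
have [d3 d30 f2] := fS _ eM0; have [d4 d40 g2] := gT _ eM0.
exists (Num.min (Num.min d1 d2) (Num.min (Num.min d3 d4) (e / M))).
  by rewrite !lt_min d10 d20 d30 d40.
move=> z; rewrite !lt_min => /andP[/andP[/f1{}f1 /g1{}g1]].
move=> /andP[/andP[/f2{}f2 /g2{}g2] zd].
set h := `|z - x| in f1 g1 f2 g2 zd *.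
have h0 : 0 <= h by rewrite /h.
rewrite UE (_ : _ - _ = B (f z - f x - S (z - x)) (g x)
   + B (f x) (g z - g x - T (z - x)) + B (f z - f x) (g z - g x)); last first.
  by rewrite !(bilinDl, bilinDr, bilinNl, bilinNr); lmod.
apply: (le_trans (ler_normD _ _)).
apply: (@le_trans _ _ (K * ((e / M * h) * `|g x|) + K * (`|f x| * (e / M * h)) +
    K * (((`|S| + 1) * h) * ((`|T| + 1) * (e / M))))).
  apply: lerD.
    by apply: (le_trans (ler_normD _ _)); apply: lerD; apply: bilin_le.
  apply: bilin_le => //; apply: (le_trans g1).
  by rewrite ler_wpM2l// ?addr_ge0// ltW.
rewrite [leLHS](_ : _ = (M - 1) / M * (e * h)); last by rewrite /M; ring.
rewrite ler_piMl ?mulr_ge0// ?ltW//.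
by rewrite ltr_pdivrMr// mul1r ltrBlDr ltrDl.
Qed.

End bilinear.

Lemma Cfin_bilin n : forall (Y1 Y2 Z : normedModType R) (B : Y1 -> Y2 -> Z) K U
    (f : X -> Y1) (g : X -> Y2), open U -> bounded_bilinear B K ->
  Cfin n U f -> Cfin n U g -> Cfin n U (fun x => B (f x) (g x)).
Proof.
elim: n => [|n IH] Y1 Y2 Z B K U f g oU bB.
  move=> /Cfin0P-/(_ oU) cf /Cfin0P-/(_ oU) cg; apply/Cfin0P => // x Ux e e0.
  have [K0 _ _ BK] := bB.
  pose M := K * (`|g x| + 1 + `|f x|) + 1.
  have M0 : 0 < M by rewrite ltr_wpDl// mulr_ge0// !addr_ge0.
  have eM0 : 0 < e / M by rewrite divr_gt0.
  have [d1 d10 f1] := cf x Ux _ eM0; have [d2 d20 g1] := cg x Ux _ eM0.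
  have [d3 d30 g2] := cg x Ux _ ltr01.
  exists (Num.min d1 (Num.min d2 d3)); first by rewrite !lt_min d10 d20.
  move=> z; rewrite !lt_min => /andP[/f1{}f1 /andP[/g1{}g1 /g2{}g2]].
  rewrite (_ : _ - _ = B (f z - f x) (g z) + B (f x) (g z - g x)); last first.
    by rewrite !(bilinDl bB, bilinDr bB, bilinNl bB, bilinNr bB); lmod.
  apply: (le_trans (ler_normD _ _)).
  apply: (@le_trans _ _ (K * (e / M * (`|g x| + 1)) + K * (`|f x| * (e / M)))).
    apply: lerD; apply: (bilin_le bB) => //.
    by rewrite -[g z](subrK (g x)) (le_trans (ler_normD _ _))// addrC lerD2l.
  rewrite [leLHS](_ : _ = (M - 1) / M * e); last by rewrite /M; ring.
  rewrite ler_piMl ?ltW//.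
  by rewrite ltr_pdivrMr// mul1r ltrBlDr ltrDl.
move=> cf cg; have [[B1 B2] /= [bB1 bB2 B1E B2E]] := bilin_derivative bB.
apply: (@Cfin_succ _ _ _ _
  (fun x => B1 (frechet f x) (g x) + B2 (f x) (frechet g x))) => //.
  move=> x Ux; apply: (has_frechet_bilin bB (has_frechet_frechet (cf.1 x Ux))
    (has_frechet_frechet (cg.1 x Ux))) => v.
  by rewrite clin_addE B1E B2E.
apply: CfinD => //.
  by apply: (IH _ _ _ _ K) => //; [exact: cf.2|exact: CfinS].
by apply: (IH _ _ _ _ K) => //; [exact: CfinS|exact: cg.2].
Qed.

End finite_smoothness.

(** * A smooth step function *)

Section scalar_composition.
Context {R : realType} {X : normedModType R}.

Lemma is_derive_has_frechet (th : R -> R) (t a : R) : is_derive t 1 th a ->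
  exists2 T : 'L(R, R), (forall v, T v = v * a) & has_frechet th t T.
Proof.
move=> [dth Eth]; have df : differentiable th t by exact/derivable1_diffP.
have [_ E] := (has_frechetP th t (frechet th t)).1 (has_frechet_frechet df).
exists (frechet th t); last exact: has_frechet_frechet.
move=> v; rewrite -{1}[v]mulr1 (clinZ (frechet th t) v 1) frechetE//.
by rewrite -deriveE// Eth.
Qed.

Lemma has_frechet_scalar_comp (th : R -> R) (p : X -> R) x (S : 'L(X, R)) a :
  (exists2 T : 'L(R, R), (forall v, T v = v * a) & has_frechet th (p x) T) ->
  has_frechet p x S -> has_frechet (fun z => th (p z)) x (a *: S).
Proof.
move=> [T Ta thT] pS; apply: (has_frechet_comp pS thT) => z.
by rewrite Ta clin_scaleE mulrC.
Qed.

End scalar_composition.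

Section flat_functions.
Context {R : realType}.

(** For [k = 0] this is the classical smooth function [exp (-1/t)] extended by zero. The factors
    [t^-k] are included because the derivative of [flat k] is then a combination of functions of the
    same family. *)
Definition flat (k : nat) (t : R) : R :=
  if 0 < t then t^-1 ^+ k * expR (- t^-1) else 0.

Lemma flat_ge0 k t : 0 <= flat k t.
Proof.
rewrite /flat; case: ifPn => // t0.
by rewrite mulr_ge0 ?expR_ge0// exprn_ge0// invr_ge0 ltW.
Qed.

(** With [u = 1/t] this is [u^N / N! <= exp u] for [N = k + m + 1]. The case [m = 1] gives the
    quadratic bound behind differentiability at 0. *)
Lemma flat_le k m t : `|flat k t| <= (k + m).+1`!%:R * `|t| ^+ m.+1.
Proof.
rewrite ger0_norm ?flat_ge0// /flat; case: ifPn => t0; last first.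
  by rewrite mulr_ge0// exprn_ge0.
rewrite gtr0_norm// -ler_pdivrMr ?exprn_gt0// -exprVn mulrAC -exprD.
have u0 : 0 <= t^-1 by rewrite invr_ge0 ltW.
have := expR_ge1Dxn (k + m) u0; rewrite -addnS expRN.
move=> H; rewrite ler_pdivrMr ?expR_gt0// mulrC -ler_pdivrMr; last first.
  by rewrite ltr0n fact_gt0.
by apply: le_trans H; rewrite lerDr.
Qed.

Lemma flat_derivative k t : exists2 T : 'L(R, R),
  (forall v, T v = v * (flat k.+2 t - k%:R * flat k.+1 t)) &
  has_frechet (flat k) t T.
Proof.
have [t0|t0|->] := ltrgt0P t.
- have tn0 : t != 0 by rewrite gt_eqF.
  have Dinv := @is_deriveV R id t 1 1 tn0 (is_derive_id t 1).
  have Dexp : is_derive t 1 (fun s : R => expR (- s^-1)) (expR (- t^-1) * t^-1 ^+ 2).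
    apply: (@is_derive_eq _ _ _ _ _ _ _ _
      (is_derive1_comp (is_derive_expR _) (is_deriveN Dinv))).
    by rewrite scaleNr opprK [_ *: _]mulr1 exprVn.
  have [T TE fT] := is_derive_has_frechet (is_deriveM (is_deriveX k Dinv) Dexp).
  exists T.
    move=> v; rewrite TE /flat t0; congr (_ * _).
    rewrite exprfctE scaleNr scalerN [_ *: 1]mulr1 /GRing.scale/=.
    rewrite -!exprVn.
    by case: k {T TE fT} => [|k] /=; rewrite !exprS ?expr0; ring.
  apply: (has_frechet_near_eq t0 _ fT) => s st.
  rewrite fctE/= exprfctE /flat ifT//.
  by move: st; rewrite distrC => /ltr_normlW; rewrite ltrBlDr ltrDl.
- exists 0.
    by move=> v; rewrite /flat ltNge ltW//= mulr0 subr0 mulr0.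
  have nt0 : 0 < - t by rewrite oppr_gt0.
  apply: (has_frechet_near_eq nt0 _ (has_frechet_cst 0 t)) => s st.
  rewrite /flat ifF//; apply/negbTE; rewrite -leNgt ltW//.
  by have := ltr_normlW st; rewrite ltrBlDr addNr.
- exists 0.
    by move=> v; rewrite /flat ltxx /= mulr0 subr0 mulr0.
  move=> e e0; pose c : R := (k + 1).+1`!%:R.
  have c0 : 0 < c by rewrite ltr0n fact_gt0.
  exists (e / c); first by rewrite divr_gt0.
  move=> z; rewrite subr0 => zd; rewrite (clin_zeroE z) subr0.
  rewrite {2}/flat ltxx subr0; apply: (le_trans (flat_le k 1 z)).
  by rewrite expr2 mulrA ler_wpM2r// mulrC -ler_pdivlMr// ltW.
Qed.

(** By the mean value theorem it suffices to bound the derivative [flat 2], which is [u^2 exp (-u)]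
    with [u = 1/x] for positive [x]; now [exp u >= 1 + u^2/2]. *)
Lemma flat_lip s t : `|flat 0 s - flat 0 t| <= 2 * `|s - t|.
Proof.
wlog st : s t / t < s.
  move=> H; have [/H//|/H|->] := ltgtP t s; first by rewrite distrC (distrC t).
  by rewrite !subrr !normr0 mulr0.
have H (x : R) : is_derive x 1 (flat 0 : R -> R) (flat 2 x).
  have [T TE fT] := flat_derivative 0 x.
  have [df ET] := (has_frechetP _ _ _).1 fT.
  apply: DeriveDef; first exact/derivable1_diffP.
  rewrite deriveE// -frechetE// ET.
  by rewrite TE mul1r mul0r subr0.
have ctf : {within `[t, s], continuous (flat 0 : R -> R)}.
  apply: continuous_subspaceT => x.
  by apply: differentiable_continuous; apply/derivable1_diffP; have [] := H x.
have [x _ ->] := MVT st (fun x _ => H x) ctf.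
rewrite normrM ler_wpM2r//.
rewrite ger0_norm ?flat_ge0// /flat; case: ifPn => // x0.
rewrite expRN ler_pdivrMr ?expR_gt0//.
have u0 : 0 <= x^-1 by rewrite invr_ge0 ltW.
have := expR_ge1Dxn 1 u0; rewrite (_ : 2`!%:R = 2)//; nra.
Qed.

Lemma flat0_le1 t : flat 0 t <= 1.
Proof.
rewrite /flat; case: ifPn => // t0.
by rewrite mul1r -[leRHS]expR0 ler_expR oppr_le0 invr_ge0 ltW.
Qed.

Lemma flat0_gt0 t : 0 < t -> 0 < flat 0 t.
Proof. by move=> t0; rewrite /flat t0 mul1r expR_gt0. Qed.

Lemma flat0_nondec s t : s <= t -> flat 0 s <= flat 0 t.
Proof.
move=> st; rewrite {1}/flat; case: ifPn => [s0|_]; last exact: flat_ge0.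
have t0 := lt_le_trans s0 st.
by rewrite /flat t0 !mul1r ler_expR lerN2 lef_pV2.
Qed.

Lemma flat0_le0 t : t <= 0 -> flat 0 t = 0.
Proof. by move=> t0; rewrite /flat ltNge t0. Qed.

Definition step (t : R) : R := flat 0 (2 - t) / (flat 0 (2 - t) + flat 0 (t - 1)).

(** The two arguments add up to 1, so one of them is at least 1/2. *)
Lemma step_den_ge t : flat 0 2^-1 <= flat 0 (2 - t) + flat 0 (t - 1).
Proof.
have [H|H] : 2^-1 <= 2 - t \/ 2^-1 <= t - 1 by lra.
  by rewrite (le_trans (flat0_nondec H))// lerDl flat_ge0.
by rewrite (le_trans (flat0_nondec H))// lerDr flat_ge0.
Qed.

Lemma step_den_gt0 t : 0 < flat 0 (2 - t) + flat 0 (t - 1).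
Proof. by apply: lt_le_trans (step_den_ge t); apply: flat0_gt0. Qed.

Lemma step01 t : 0 <= step t <= 1.
Proof.
rewrite /step; apply/andP; split; first by rewrite divr_ge0 ?flat_ge0// ltW ?step_den_gt0.
by rewrite ler_pdivrMr ?step_den_gt0// mul1r lerDl flat_ge0.
Qed.

Lemma step_eq1 t : t <= 1 -> step t = 1.
Proof.
move=> t1; rewrite /step (@flat0_le0 (t - 1)) ?subr_le0// addr0 divff//.
by rewrite gt_eqF// flat0_gt0//; lra.
Qed.

Lemma step_eq0 t : 2 <= t -> step t = 0.
Proof. by move=> t2; rewrite /step flat0_le0 ?subr_le0// mul0r. Qed.

(** In the difference of two values of [step] the numerator is at most [4 |s - t|], and each
    denominator is at least [flat 0 (1/2)]. *)
Definition step_lip : R := 4 / (flat 0 2^-1) ^+ 2.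

Lemma step_lipP s t : `|step s - step t| <= step_lip * `|s - t|.
Proof.
rewrite /step.
set a := flat 0 (2 - s); set b := flat 0 (s - 1).
set c := flat 0 (2 - t); set d := flat 0 (t - 1).
have ab : flat 0 2^-1 <= a + b := step_den_ge s.
have cd : flat 0 2^-1 <= c + d := step_den_ge t.
have m0 : 0 < flat 0 (2^-1 : R) by exact: flat0_gt0.
have ab0 := lt_le_trans m0 ab; have cd0 := lt_le_trans m0 cd.
have -> : a / (a + b) - c / (c + d) =
    ((a - c) * d - c * (b - d)) / ((a + b) * (c + d)).
  by field; rewrite !gt_eqF.
have ac : `|a - c| <= 2 * `|s - t|.
  by apply: (le_trans (flat_lip _ _)); rewrite (_ : 2 - s - (2 - t) = - (s - t)) ?normrN//; ring.
have bd : `|b - d| <= 2 * `|s - t|.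
  by apply: (le_trans (flat_lip _ _)); rewrite (_ : s - 1 - (t - 1) = s - t)//; ring.
rewrite normrM normfV (ger0_norm (mulr_ge0 (ltW ab0) (ltW cd0))).
rewrite ler_pdivrMr ?mulr_gt0//; apply: (@le_trans _ _ (4 * `|s - t|)).
  apply: (le_trans (ler_normB _ _)); rewrite !normrM.
  have -> : 4 * `|s - t| = (2 * `|s - t|) * 1 + 1 * (2 * `|s - t|) by ring.
  by apply: lerD; apply: ler_pM => //; rewrite ger0_norm ?flat_ge0 ?flat0_le1.
rewrite mulrAC ler_wpM2r// /step_lip mulrAC ler_pdivlMr ?exprn_gt0//.
by rewrite ler_wpM2l// expr2 ler_pM// ltW.
Qed.

End flat_functions.

(** * Closure properties of C^k maps *)

Section smooth_closure.
Context {R : realType} {X : normedModType R}.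
Implicit Types (U V : set X).

Lemma scale_bilinear {Y : normedModType R} :
  bounded_bilinear (fun (a : R) (y : Y) => a *: y) 1.
Proof.
split => //; first by move=> v a x y /=; rewrite scalerDl scalerA.
  by move=> u a x y /=; rewrite scalerDr !scalerA mulrC.
by move=> u v; rewrite normrZ mul1r.
Qed.

Lemma eval_bilinear {Y Z : normedModType R} :
  bounded_bilinear (fun (T : 'L(Y, Z)) (y : Y) => T y) 1.
Proof.
split => //; first by move=> u a x y /=; rewrite clinD clinZ.
by move=> u v; rewrite mul1r clin_le.
Qed.

Lemma Cfin_scale n {Y : normedModType R} U (a : X -> R) (f : X -> Y) : open U ->
  Cfin n U a -> Cfin n U f -> Cfin n U (fun x => a x *: f x).
Proof. by move=> oU; apply: Cfin_bilin => //; exact: scale_bilinear. Qed.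

Lemma Cfin_postcomp n {Y Z : normedModType R} U (T : 'L(Y, Z)) (f : X -> Y) :
  open U -> Cfin n U f -> Cfin n U (fun x => T (f x)).
Proof.
move=> oU cf; apply: (@Cfin_bilin _ _ n _ _ _ (fun (T : 'L(Y, Z)) y => T y) 1 _
  (fun=> T)) => //; [exact: eval_bilinear|exact: Cfin_cst].
Qed.

Lemma CfinZ n {Y : normedModType R} U (a : R) (f : X -> Y) : open U ->
  Cfin n U f -> Cfin n U (fun x => a *: f x).
Proof. by move=> oU; apply: Cfin_scale => //; exact: Cfin_cst. Qed.

Lemma CfinB n {Y : normedModType R} U (f g : X -> Y) : open U ->
  Cfin n U f -> Cfin n U g -> Cfin n U (fun x => f x - g x).
Proof.
move=> oU cf cg; apply: CfinD => //.
apply: (Cfin_ext oU (f := fun x => -1 *: g x)) => [x _|]; first by rewrite scaleN1r.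
exact: CfinZ.
Qed.

Lemma Cfin_clin n {Y : normedModType R} U (T : 'L(X, Y)) : open U ->
  Cfin n U T.
Proof.
move=> oU; have fT x : has_frechet T x T.
  by move=> e e0; exists 1 => // z _; rewrite clinB subrr normr0 mulr_ge0// ltW.
by apply: CfinS => //; apply: (Cfin_succ oU (fun x _ => fT x)); exact: Cfin_cst.
Qed.

Lemma Cfin_affine n : forall (Y : normedModType R) U V (f : X -> Y) (a : R) c,
  open U -> open V -> (forall x, U x -> V (a *: (x - c))) ->
  Cfin n V f -> Cfin n U (fun x => f (a *: (x - c))).
Proof.
have aE (a : R) (z x c : X) : a *: (z - c) - a *: (x - c) = a *: (z - x).
  by lmod.
elim: n => [|n IH] Y U V f a c oU oV UV.
  move=> /Cfin0P-/(_ oV) cf; apply/Cfin0P => // x Ux e e0.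
  have [d d0 fd] := cf _ (UV _ Ux) e e0.
  exists (d / (`|a| + 1)); first by rewrite divr_gt0// ltr_wpDl.
  move=> z; rewrite ltr_pdivlMr ?ltr_wpDl// => zd; apply: fd.
  rewrite aE normrZ mulrC (le_lt_trans _ zd)//.
  by rewrite ler_wpM2l// lerDl.
move=> [df cf].
apply: (@Cfin_succ _ _ _ _ _ _ (fun x => a *: frechet f (a *: (x - c)))) => //.
  move=> x /UV/df/has_frechet_frechet fT e e0.
  have a0 : 0 < `|a| + 1 by rewrite ltr_wpDl.
  have [|d d0 fd] := fT (e / (`|a| + 1)); first by rewrite divr_gt0.
  exists (d / (`|a| + 1)); first by rewrite divr_gt0// ltr_wpDl.
  move=> z; rewrite ltr_pdivlMr ?ltr_wpDl// => zd.
  have := fd (a *: (z - c)); rewrite aE normrZ clinZ clin_scaleE.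
  have ad : `|a| * `|z - x| < d.
    by rewrite mulrC (le_lt_trans _ zd)// ler_wpM2l// lerDl.
  move=> /(_ ad)/le_trans; apply.
  by rewrite mulrA ler_wpM2r// mulrAC ler_pdivrMr// ler_wpM2l ?ltW// ltrDl.
by apply: CfinZ => //; exact: IH cf.
Qed.

Lemma Cfin0_comp (Y Z : normedModType R) U (f : X -> Y) (g : Y -> Z) : open U ->
  (forall x, U x -> {for f x, continuous g}) ->
  Cfin 0 U f -> Cfin 0 U (fun x => g (f x)).
Proof.
move=> oU cg /=; rewrite !continuous_open_subspace// => cf x Ux.
by apply: continuous_comp; [exact: cf|exact/cg/set_mem].
Qed.

(** The index [k] is quantified inside the induction because differentiation raises it. *)
Lemma Cfin_flat n : forall k U (p : X -> R), open U -> Cfin n U p ->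
  Cfin n U (fun x => flat k (p x)).
Proof.
elim: n => [|n IH] k U p oU cp.
  apply: Cfin0_comp => // x _; have [T _ /has_frechetP[+ _]] := flat_derivative k (p x).
  exact: differentiable_continuous.
apply: (@Cfin_succ _ _ _ _ _ _ (fun x =>
    (flat k.+2 (p x) - k%:R * flat k.+1 (p x)) *: frechet p x)) => //.
  move=> x Ux; apply: has_frechet_scalar_comp; first exact: flat_derivative.
  by apply: has_frechet_frechet; exact: cp.1.
apply: Cfin_scale => //; last exact: cp.2.
have cp' := CfinS oU cp.
apply: CfinB => //; first exact: IH.
by apply: (@CfinZ _ _ _ k%:R) => //; exact: IH.
Qed.

Lemma Cfin_inv n : forall U (p : X -> R), open U -> (forall x, U x -> p x != 0) ->
  Cfin n U p -> Cfin n U (fun x => (p x)^-1).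
Proof.
elim: n => [|n IH] U p oU p0 cp.
  apply: (@Cfin0_comp _ _ _ p (fun t : R => t^-1)) => // x Ux.
  exact: (differentiable_continuous (differentiable_Rinv (p0 x Ux))).
apply: (@Cfin_succ _ _ _ _ _ _
    (fun x => ((-1) *: ((p x)^-1 *: (p x)^-1)) *: frechet p x)) => //.
  move=> x Ux; apply: has_frechet_scalar_comp.
    apply: is_derive_has_frechet.
    have := @is_deriveV R id (p x) 1 1 (p0 x Ux) (is_derive_id _ _).
    rewrite (_ : _ *: 1 = -1 *: ((p x)^-1 *: (p x)^-1))//.
    by rewrite [_ *: 1]mulr1 scaleN1r /GRing.scale/= -expr2 exprVn.
  by apply: has_frechet_frechet; exact: cp.1.
apply: Cfin_scale => //; last exact: cp.2.
have cp' := CfinS oU cp.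
by apply: CfinZ => //; apply: Cfin_scale => //; exact: IH.
Qed.

Lemma Cfin_step n U (p : X -> R) : open U -> Cfin n U p ->
  Cfin n U (fun x => step (p x)).
Proof.
move=> oU cp.
have c1 : Cfin n U (fun x => flat 0 (2 - p x)).
  by apply: Cfin_flat => //; apply: CfinB => //; exact: Cfin_cst.
have c2 : Cfin n U (fun x => flat 0 (p x - 1)).
  by apply: Cfin_flat => //; apply: CfinB => //; exact: Cfin_cst.
apply: (@Cfin_scale n _ U _ _ oU c1); apply: Cfin_inv => //.
  by move=> x _; rewrite gt_eqF// step_den_gt0.
exact: CfinD.
Qed.

(** The finite orders that smoothness of order [k] demands; through [CsmoothP] the closure lemmas
    for [Csmooth] reduce to those for [Cfin], with infinite order included. *)
Definition is_order (k : option nat) n := if k is Some m then n = m else True.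

Lemma CsmoothP k {Y : normedModType R} U (f : X -> Y) :
  Csmooth k U f <-> forall n, is_order k n -> Cfin n U f.
Proof.
case: k => [m|] /=; split => [H n|H]; [by move=> ->|exact: H|by []|].
by move=> n; exact: H.
Qed.

Lemma Csmooth_ext k {Y : normedModType R} U (f g : X -> Y) : open U ->
  (forall x, U x -> f x = g x) -> Csmooth k U f -> Csmooth k U g.
Proof.
by move=> oU fg /CsmoothP cf; apply/CsmoothP => n /cf; exact: Cfin_ext.
Qed.

Lemma Csmooth_sub k {Y : normedModType R} U V (f : X -> Y) :
  open U -> open V -> V `<=` U -> Csmooth k U f -> Csmooth k V f.
Proof.
by move=> oU oV VU /CsmoothP cf; apply/CsmoothP => n /cf; exact: Cfin_sub.
Qed.

Lemma Csmooth_local k {Y : normedModType R} U (f : X -> Y) : open U ->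
  (forall x, U x -> exists2 r, 0 < r & Csmooth k (ball x r) f) -> Csmooth k U f.
Proof.
move=> oU H; apply/CsmoothP => n kn; apply: Cfin_local => // x /H[r r0].
by move=> /CsmoothP cf; exists r => //; exact: cf.
Qed.

Lemma Csmooth_cst k {Y : normedModType R} U (c : Y) : open U ->
  Csmooth k U (fun=> c).
Proof. by move=> oU; apply/CsmoothP => n _; exact: Cfin_cst. Qed.

Lemma Csmooth_clin k {Y : normedModType R} U (T : 'L(X, Y)) : open U ->
  Csmooth k U T.
Proof. by move=> oU; apply/CsmoothP => n _; exact: Cfin_clin. Qed.

Lemma CsmoothD k {Y : normedModType R} U (f g : X -> Y) : open U ->
  Csmooth k U f -> Csmooth k U g -> Csmooth k U (fun x => f x + g x).
Proof.
by move=> oU /CsmoothP cf /CsmoothP cg; apply/CsmoothP => n kn;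
  apply: CfinD => //; [exact: cf|exact: cg].
Qed.

Lemma CsmoothB k {Y : normedModType R} U (f g : X -> Y) : open U ->
  Csmooth k U f -> Csmooth k U g -> Csmooth k U (fun x => f x - g x).
Proof.
by move=> oU /CsmoothP cf /CsmoothP cg; apply/CsmoothP => n kn;
  apply: CfinB => //; [exact: cf|exact: cg].
Qed.

Lemma Csmooth_scale k {Y : normedModType R} U (a : X -> R) (f : X -> Y) :
  open U -> Csmooth k U a -> Csmooth k U f -> Csmooth k U (fun x => a x *: f x).
Proof.
by move=> oU /CsmoothP cf /CsmoothP cg; apply/CsmoothP => n kn;
  apply: Cfin_scale => //; [exact: cf|exact: cg].
Qed.

Lemma CsmoothZ k {Y : normedModType R} U (a : R) (f : X -> Y) : open U ->
  Csmooth k U f -> Csmooth k U (fun x => a *: f x).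
Proof. by move=> oU; apply: Csmooth_scale => //; exact: Csmooth_cst. Qed.

Lemma Csmooth_postcomp k {Y Z : normedModType R} U (T : 'L(Y, Z)) (f : X -> Y) :
  open U -> Csmooth k U f -> Csmooth k U (fun x => T (f x)).
Proof.
by move=> oU /CsmoothP cf; apply/CsmoothP => n /cf; exact: Cfin_postcomp.
Qed.

Lemma Csmooth_affine k {Y : normedModType R} U V (f : X -> Y) (a : R) c :
  open U -> open V -> (forall x, U x -> V (a *: (x - c))) ->
  Csmooth k V f -> Csmooth k U (fun x => f (a *: (x - c))).
Proof.
by move=> oU oV UV /CsmoothP cf; apply/CsmoothP => n /cf; exact: Cfin_affine.
Qed.

Lemma Csmooth_step k U (p : X -> R) : open U -> Csmooth k U p ->
  Csmooth k U (fun x => step (p x)).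
Proof.
by move=> oU /CsmoothP cf; apply/CsmoothP => n /cf; exact: Cfin_step.
Qed.

Lemma Csmooth_C1 k {Y : normedModType R} U (f : X -> Y) : k <> Some 0%N ->
  open U -> Csmooth k U f -> Cfin 1 U f.
Proof.
move=> k0 oU; case: k k0 => [[//|n] _ |_ /(_ 1%N)//].
by rewrite /Csmooth; elim: n => // n IH /(CfinS oU)/IH.
Qed.

End smooth_closure.

(** * The Hahn-Banach theorem *)

Section hahn_banach.
Context {R : realType} {Y : normedModType R} (y0 : Y).

(** Graphs of linear functionals on subspaces, dominated by the norm and sending [y0] to its norm.
    Extension of functionals becomes inclusion of sets. Single-valuedness is implied: if [(y, r)]
    and [(y, s)] lie in [S], so do [(0, s - r)] and [(0, r - s)], and domination makes both second
    entries nonpositive. *)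
Definition dominated_graph (S : set (Y * R)) :=
  [/\ S (y0, `|y0|),
      forall (a : R) u v, S u -> S v -> S (a *: u.1 + v.1, a * u.2 + v.2) &
      forall u, S u -> u.2 <= `|u.1|].

Lemma dominated_graph_maximal : exists2 S, dominated_graph S &
  forall B, S `<=` B -> dominated_graph B -> B `<=` S.
Proof.
have [|S [SP Smax]] := @Zorn_bigcup (Y * R)%type
    (fun S => S = set0 \/ dominated_graph S).
  move=> F FP totF.
  have [F0|/existsNP[S0 /not_implyP[FS0 S0n0]]] :=
      pselect (forall S, F S -> S = set0).
    by left; rewrite bigcup0.
  right; split.
  - by exists S0 => //; case: (FP _ FS0) => // -[].
  - move=> a u v [S1 FS1 Su] [S2 FS2 Sv].
    have [S12|S21] := totF _ _ FS1 FS2.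
      exists S2 => //; have [E|[_ + _]] := FP _ FS2; first by move: Sv; rewrite E.
      by apply => //; exact: S12.
    exists S1 => //; have [E|[_ + _]] := FP _ FS1; first by move: Su; rewrite E.
    by apply => //; exact: S21.
  - move=> u [S FS Su]; have [E|[_ _]] := FP _ FS; last exact.
    by move: Su; rewrite E.
have [S0|dS] := SP; last first.
  exists S => // B SB dB; apply: contrapT => nBS.
  by apply: (Smax B); [split|right].
exfalso; apply: (Smax [set (a *: y0, a * `|y0|) | a in [set: R]]).
  rewrite S0; split => // /(_ (1 *: y0, 1 * `|y0|)); apply.
  by exists 1.
right; split.
- by exists 1 => //; rewrite scale1r mul1r.
- move=> a _ _ [b _ <-] [c _ <-] /=; exists (a * b + c) => //.
  by rewrite scalerDl scalerA mulrDl mulrA.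
- by move=> _ [a _ <-] /=; rewrite normrZ ler_wpM2r// ler_norm.
Qed.

(** The one-dimensional extension step. A value [c] at [x] is admissible when
    [s - |u - x| <= c <= |v + x| - t] for all [(u, s)] and [(v, t)] in [S]; the triangle inequality
    and domination put every left side below every right side, so the supremum [c] of the left sides
    works. Maximality then forces [(x, c)] into [S]. *)
Lemma dominated_graph_total S : dominated_graph S ->
  (forall B, S `<=` B -> dominated_graph B -> B `<=` S) ->
  forall x, exists r, S (x, r).
Proof.
move=> [Sy0 Slin Sb] Smax x.
have S0 : S (0, 0).
  by have := Slin (-1) _ _ Sy0 Sy0; rewrite /= scaleN1r addNr mulN1r addNr.
have Sscale a u : S u -> S (a *: u.1, a * u.2).
  by move=> Su; have := Slin a _ _ Su S0; rewrite /= !addr0.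
pose E := [set u.2 - `|u.1 - x| | u in S].
have Eub v : S v -> ubound E (`|v.1 + x| - v.2).
  move=> Sv _ [u Su <-]; rewrite lerBlDr addrAC lerBrDr.
  have := Slin 1 _ _ Su Sv; rewrite scale1r mul1r => /Sb/= /le_trans; apply.
  rewrite (_ : u.1 + v.1 = (v.1 + x) + (u.1 - x)); last by lmod.
  exact: ler_normD.
have Es : has_sup E.
  by split; [exists (0 - `|0 - x|); exists (0, 0)|exists (`|0 + x| - 0); exact: Eub S0].
pose c := sup E.
have Hl u : S u -> u.2 - c <= `|u.1 - x|.
  move=> Su; rewrite lerBlDr -lerBlDl; apply: ub_le_sup; first exact: Es.2.
  by exists u.
have Hr u : S u -> u.2 + c <= `|u.1 + x|.
  by move=> Su; rewrite -lerBrDl; apply: ge_sup; [exact: Es.1|exact: Eub].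
pose B := [set (w.1.1 + w.2 *: x, w.1.2 + w.2 * c) |
            w in [set w : (Y * R) * R | S w.1]].
have SB : S `<=` B.
  by move=> [y r] Sy; exists ((y, r), 0) => //=; rewrite scale0r mul0r !addr0.
suff dB : dominated_graph B.
  exists c; apply: (Smax B SB dB); exists ((0, 0), 1) => //=.
  by rewrite scale1r mul1r !add0r.
split; first exact: SB.
  move=> a _ _ [[u s] /= Su <-] [[v t] /= Sv <-] /=.
  exists ((a *: u.1 + v.1, a * u.2 + v.2), a * s + t) => /=; first exact: Slin.
  by congr pair; [lmod|ring].
move=> _ [[u t] /= Su <-] /=.
have [t0|t0|->] := ltrgt0P t; last by rewrite scale0r mul0r !addr0; exact: Sb.
- have := Hr _ (Sscale t^-1 _ Su); rewrite /= -(ler_pM2l t0).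
  rewrite mulrDr mulrA divff ?gt_eqF// mul1r => /le_trans; apply.
  rewrite -{1}(gtr0_norm t0) -normrZ scalerDr scalerA divff ?gt_eqF//.
  by rewrite scale1r.
- have nt0 : 0 < - t by rewrite oppr_gt0.
  have := Hl _ (Sscale (- t)^-1 _ Su); rewrite /= -(ler_pM2l nt0).
  rewrite mulrBr mulrA divff ?gt_eqF// mul1r mulNr opprK => /le_trans; apply.
  rewrite -{1}(gtr0_norm nt0) -normrZ scalerBr scalerA divff ?gt_eqF//.
  by rewrite scale1r scaleNr opprK.
Qed.

(** Used to pass from approximation of [Y]-valued maps to approximation of real functions, which
    yields the partition functions. *)
Lemma nonzero_functional : y0 != 0 -> exists l : 'L(Y, R), l y0 != 0.
Proof.
move=> y00; have [S dS Smax] := dominated_graph_maximal.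
have /choice[l Sl] := dominated_graph_total dS Smax.
have [Sy0 Slin Sb] := dS.
have Suniq y r s : S (y, r) -> S (y, s) -> r = s.
  have H r' s' : S (y, r') -> S (y, s') -> s' <= r'.
    move=> Sr Ss; have := Sb _ (Slin (-1) _ _ Sr Ss).
    by rewrite /= scaleN1r addNr normr0 mulN1r addrC subr_le0.
  by move=> Sr Ss; apply/eqP; rewrite eq_le (H s r)// (H r s).
have linl : linear l.
  by move=> a u v; apply: (Suniq (a *: u + v)) => //; exact: Slin (Sl u) (Sl v).
have [|L LE] := @linear_bounded_clin _ _ _ l 1 linl.
  move=> y; rewrite mul1r ler_norml; apply/andP; split; last exact: Sb (Sl y).
  have := Sb _ (Sl (- y)); rewrite /= normrN lerNl.
  have := Slin (-1) _ _ (Sl y) (Sl 0); rewrite /= scaleN1r addr0 mulN1r.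
  have -> : l 0 = 0.
    by have := linl 1 0 0; rewrite !scale1r addr0 => E; lra.
  by rewrite addr0 => /Suniq-/(_ _ (Sl (- y))) ->.
exists L; rewrite LE.
by rewrite (Suniq _ _ _ (Sl y0) Sy0) normr_eq0.
Qed.

End hahn_banach.

(** * Lipschitz conditions *)

Section lipschitz.
Context {R : realType} {X Y : normedModType R}.
Implicit Types (u v : X -> Y) (S T : 'L(X, Y)).

Definition lip_on (A : set X) u (K : R) :=
  forall x y, A x -> A y -> `|u x - u y| <= K * `|x - y|.

Lemma lip_onP (A : set X) u K : K.-lipschitz_A u <-> lip_on A u K.
Proof.
split=> [H x y Ax Ay|H [x y] /= [Ax Ay]]; last exact: H.
exact: (H (x, y) (conj Ax Ay)).
Qed.

Lemma lip_on_sub (A B : set X) u K : A `<=` B -> lip_on B u K -> lip_on A u K.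
Proof. by move=> AB H x y /AB Bx /AB By; exact: H. Qed.

Definition pointwise_lip u (p : X) (K : R) := forall e, 0 < e ->
  exists2 r, 0 < r & forall z, `|z - p| < r -> `|u z - u p| <= (K + e) * `|z - p|.

(** A mean value inequality without derivatives. Let [c] be the supremum of the parameters at which
    the bound with slope [K + e'] holds. The pointwise estimate at [p c] shows that the bound holds
    at [c] itself, and also slightly beyond [c] unless [c = 1]. *)
Lemma segment_lip u x y K :
  (forall t, 0 <= t <= 1 -> pointwise_lip u (x + t *: (y - x)) K) ->
  `|u y - u x| <= K * `|y - x|.
Proof.
move=> uK; set v := y - x; pose p t := x + t *: v.
have pB s t : p s - p t = (s - t) *: v by rewrite /p; lmod.
have p1 : p 1 = y by rewrite /p /v; lmod.
have p0 : p 0 = x by rewrite /p; lmod.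
apply/ler_addgt0Pr => e e0.
pose e' := e / (`|v| + 1).
have v10 : 0 < `|v| + 1 by rewrite ltr_wpDl.
have e'0 : 0 < e' by rewrite divr_gt0.
suff H : `|u (p 1) - u (p 0)| <= (K + e') * `|v|.
  rewrite -p1 -p0; apply: (le_trans H).
  by rewrite mulrDl lerD2l /e' mulrAC ler_pdivrMr// ler_wpM2l ?ltW// ltrDl.
pose S := [set t | 0 <= t <= 1 /\ `|u (p t) - u (p 0)| <= (K + e') * (t * `|v|)].
have S0 : S 0 by split; rewrite ?lexx ?ler01//= subrr normr0 mul0r mulr0.
have Sub : has_ubound S by exists 1 => t [/andP[]].
have Ssup : has_sup S by split; first by exists 0.
pose c := sup S.
have c01 : 0 <= c <= 1.
  apply/andP; split; first exact: ub_le_sup.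
  by apply: ge_sup; [exists 0|move=> t [/andP[]]].
have [r r0 ur] := uK c c01 _ e'0.
pose d := r / (`|v| + 1).
have d0 : 0 < d by rewrite divr_gt0.
have near_c t : `|t - c| < d -> `|u (p t) - u (p c)| <= (K + e') * (`|t - c| * `|v|).
  move=> td; have := ur (p t); rewrite pB normrZ; apply.
  apply: (@le_lt_trans _ _ (`|t - c| * (`|v| + 1))).
    by rewrite ler_wpM2l// lerDl.
  by rewrite -ltr_pdivlMr.
have Sc : S c.
  split => //.
  have [s Ss cs] := sup_adherent d0 Ssup.
  have sc : s <= c by apply: ub_le_sup.
  have H1 : `|s - c| < d.
    by rewrite distrC ger0_norm ?subr_ge0// ltrBlDr -ltrBlDl.
  have := near_c _ H1; rewrite distrC (distrC s) (ger0_norm (_ : 0 <= c - s)) ?subr_ge0//.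
  have [_ /= H2] := Ss; move=> H3.
  rewrite -[u (p c)](subrK (u (p s))) -addrA (le_trans (ler_normD _ _))//.
  apply: (le_trans (lerD H3 H2)); rewrite -mulrDr -mulrDl subrK//.
have [c1|c1] := ltP c 1; last first.
  have c_1 : c = 1 by apply/eqP; rewrite eq_le c1 andbT; case/andP: c01.
  by have [_] := Sc; rewrite c_1 mul1r.
exfalso; pose t := c + Num.min (d / 2) (1 - c).
have m0 : 0 < Num.min (d / 2) (1 - c) by rewrite lt_min divr_gt0// subr_gt0.
have ct : c < t by rewrite ltrDl.
have St : S t.
  split.
    rewrite (le_trans _ (ltW ct)); last by case/andP: c01.
    by rewrite /= /t addrC -lerBrDr ge_min lexx orbT.
  have tc : t - c = Num.min (d / 2) (1 - c) by rewrite /t addrC addKr.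
  have H1 : `|t - c| < d.
    rewrite tc gtr0_norm// gt_min; apply/orP; left.
    by rewrite ltr_pdivrMr// ltr_pMr// ltr1n.
  have H3 := near_c _ H1; have [_ H2] := Sc.
  rewrite gtr0_norm ?subr_gt0// in H3.
  rewrite -[u (p t)](subrK (u (p c))) -addrA (le_trans (ler_normD _ _))//.
  by apply: (le_trans (lerD H3 H2)); rewrite -mulrDr -mulrDl subrK.
by have := ub_le_sup Sub St; rewrite leNgt ct.
Qed.

Lemma ball_convex (c x y : X) r t : `|x - c| < r -> `|y - c| < r -> 0 <= t <= 1 ->
  `|x + t *: (y - x) - c| < r.
Proof.
move=> xr yr /andP[t0 t1].
rewrite (_ : _ - c = (1 - t) *: (x - c) + t *: (y - c)); last by lmod.
apply: (le_lt_trans (ler_normD _ _)); rewrite !normrZ (ger0_norm t0).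
rewrite ger0_norm ?subr_ge0//.
move: xr yr; set a := `|x - c|; set b := `|y - c| => xr yr.
have [t00|tn0] := eqVneq t 0; first by rewrite t00; lra.
have {tn0}t0 : 0 < t by rewrite lt_neqAle eq_sym tn0.
have h1 : 0 < t * (r - b) by rewrite mulr_gt0// subr_gt0.
have h2 : 0 <= (1 - t) * (r - a) by rewrite mulr_ge0 ?subr_ge0// ltW.
by nra.
Qed.

Lemma ball_lip u c r K : (forall p, `|p - c| < r -> pointwise_lip u p K) ->
  lip_on (ball c r) u K.
Proof.
move=> uK x y /ball_distE xr /ball_distE yr; apply: segment_lip => t t01.
by apply: uK; exact: ball_convex.
Qed.

(** The local Lipschitz constant of [u - T] at [y] is at most [b]. For [b = 0] this is strict
    differentiability at [y] with derivative [T]; for [T = 0] it bounds the local Lipschitz constant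
    of [u]. *)
Definition slip u (y : X) T (b : R) := forall e, 0 < e -> exists2 r, 0 < r &
  forall x z, `|x - y| < r -> `|z - y| < r ->
    `|u x - u z - T (x - z)| <= (b + e) * `|x - z|.

Lemma slip_ball u c r y T b : `|y - c| < r ->
  lip_on (ball c r) (fun x => u x - T x) b -> slip u y T b.
Proof.
move=> yr uT e e0; exists (r - `|y - c|); first by rewrite subr_gt0.
have H x : `|x - y| < r - `|y - c| -> ball c r x.
  move=> xy; apply/ball_distE; rewrite -(subrK y x) -addrA.
  by rewrite (le_lt_trans (ler_normD _ _))// -ltrBrDr.
move=> x z /H xr /H zr; rewrite clinB.
rewrite (_ : _ - _ = u x - T x - (u z - T z)); last by lmod.
by rewrite (le_trans (uT _ _ xr zr))// ler_wpM2r// lerDl ltW.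
Qed.

Lemma slip_le u y T b b' : b <= b' -> slip u y T b -> slip u y T b'.
Proof.
move=> bb H e /H[r r0 ur]; exists r => // x z xr zr.
by apply: (le_trans (ur _ _ xr zr)); rewrite ler_wpM2r// lerD2r.
Qed.

Lemma slip_shift u y T S b d : `|T - S| <= d -> slip u y T b -> slip u y S (b + d).
Proof.
move=> TS H e /H[r r0 ur]; exists r => // x z xr zr.
rewrite (_ : _ - _ = (u x - u z - T (x - z)) + (T - S) (x - z)); last first.
  by rewrite clin_subE; lmod.
rewrite (le_trans (ler_normD _ _))// (addrAC b) mulrDl.
by rewrite lerD ?ur// (le_trans (clin_le _ _))// ler_wpM2r.
Qed.

Lemma slip_near_eq u v y T b r : 0 < r ->
  (forall z, `|z - y| < r -> u z = v z) -> slip u y T b -> slip v y T b.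
Proof.
move=> r0 uv H e /H[d d0 ud]; exists (Num.min d r); first by rewrite lt_min d0.
by move=> x z; rewrite !lt_min => /andP[xd xr] /andP[zd zr];
  rewrite -!uv//; exact: ud.
Qed.

Lemma slip_pointwise u y b : slip u y 0 b -> pointwise_lip u y b.
Proof.
move=> H e /H[r r0 ur]; exists r => // z zr.
by have := ur z y zr; rewrite clin_zeroE !subr0 subrr normr0; apply.
Qed.

Lemma slipB u v y T S b c : slip u y T b -> slip v y S c ->
  slip (fun x => u x - v x) y (T - S) (b + c).
Proof.
move=> H1 H2 e e0; have e20 : 0 < e / 2 by rewrite divr_gt0.
have [r r0 ur] := H1 _ e20; have [s s0 vs] := H2 _ e20.
exists (Num.min r s); first by rewrite lt_min r0.
move=> x z; rewrite !lt_min => /andP[xr xs] /andP[zr zs].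
rewrite clin_subE (_ : _ - _ =
  (u x - u z - T (x - z)) - (v x - v z - S (x - z))); last by lmod.
rewrite (le_trans (ler_normB _ _))// (le_trans (lerD (ur _ _ xr zr) (vs _ _ xs zs)))//.
by rewrite -mulrDl ler_wpM2r// addrACA -splitr.
Qed.

Lemma slip_cts u y T b : slip u y T b -> forall e, 0 < e ->
  exists2 r, 0 < r & forall z, `|z - y| < r -> `|u z - u y| <= e.
Proof.
move=> /(_ 1 ltr01)[r r0 ur] e e0; pose M := `|b| + 1 + `|T| + 1.
have M0 : 0 < M by rewrite /M ltr_wpDl// !addr_ge0.
exists (Num.min r (e / M)); first by rewrite lt_min r0 divr_gt0.
move=> z; rewrite lt_min ltr_pdivlMr// => /andP[zr ze].
rewrite -[u z - u y](subrK (T (z - y))) (le_trans (ler_normD _ _))//.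
apply: le_trans (ltW ze).
apply: le_trans (lerD (ur z y zr _) (clin_le _ _)) _; first by rewrite subrr normr0.
rewrite -mulrDl mulrC ler_wpM2l// /M.
by have := ler_norm b; lra.
Qed.

(** The increment of the combination is a convex combination of the increments of [u] and [v] plus
    [(psi x - psi z) (u z - v z)]. Thus the slope of [psi] costs only [M] times the gap between [u]
    and [v] at [y]. *)
Lemma slip_combine u v (psi : X -> R) y T b d M r : 0 < r -> 0 <= M ->
  (forall x, 0 <= psi x <= 1) ->
  (forall x z, `|x - y| < r -> `|z - y| < r -> `|psi x - psi z| <= M * `|x - z|) ->
  slip u y T b -> slip v y T b -> `|u y - v y| <= d ->
  slip (fun x => psi x *: u x + (1 - psi x) *: v x) y T (b + M * d).
Proof.
move=> r0 M0 psi01 psiM Hu Hv uvd e e0.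
pose e1 := e / 2; have e10 : 0 < e1 by rewrite divr_gt0.
(* By continuity the gap between [u] and [v] near [y] is at most [d + 2 e2], and
   [M * 2 e2 <= e/2]. *)
pose e2 := e / 4 / (M + 1).
have M10 : 0 < M + 1 by rewrite ltr_wpDl.
have e20 : 0 < e2 by rewrite !divr_gt0.
have [r1 r10 ur] := Hu _ e10; have [r2 r20 vr] := Hv _ e10.
have [r3 r30 uc] := slip_cts Hu e20; have [r4 r40 vc] := slip_cts Hv e20.
exists (Num.min r (Num.min (Num.min r1 r2) (Num.min r3 r4))).
  by rewrite !lt_min r0 r10 r20 r30.
move=> x z; rewrite !lt_min.
move=> /andP[xr /andP[/andP[xr1 xr2] _]].
move=> /andP[zr /andP[/andP[zr1 zr2] /andP[zr3 zr4]]].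
have /andP[p0 p1] := psi01 x.
rewrite (_ : _ - _ = psi x *: (u x - u z - T (x - z)) +
  (1 - psi x) *: (v x - v z - T (x - z)) + (psi x - psi z) *: (u z - v z)); last first.
  by lmod.
have uvz : `|u z - v z| <= d + 2 * e2.
  rewrite (_ : _ - _ = (u y - v y) + ((u z - u y) - (v z - v y))); last by lmod.
  rewrite (le_trans (ler_normD _ _))// lerD// (le_trans (ler_normB _ _))//.
  by rewrite mulrC mulr2n mulrDr mulr1 lerD ?uc ?vc.
rewrite (le_trans (ler_normD _ _))//.
apply: (@le_trans _ _ ((b + e1) * `|x - z| + M * `|x - z| * (d + 2 * e2))).
  apply: lerD; last by rewrite normrZ ler_pM// psiM.
  rewrite (le_trans (ler_normD _ _))// !normrZ (ger0_norm p0).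
  rewrite (ger0_norm (_ : 0 <= 1 - psi x)) ?subr_ge0//.
  rewrite -[(b + e1) * _]mul1r -[X in X * ((b + e1) * _)](subrK (psi x)).
  rewrite addrC [X in _ <= X]mulrDl lerD// ler_wpM2l ?subr_ge0//.
    exact: vr.
  exact: ur.
rewrite mulrAC -mulrDl ler_wpM2r// mulrDr -!addrA lerD2l addrCA lerD2l.
have -> : M * (2 * e2) = (M / (M + 1)) * (e / 2) by rewrite /e2; field; rewrite gt_eqF.
rewrite [leRHS]splitr lerD2l ler_piMl ?divr_ge0 ?ltW//.
by rewrite ltr_pdivrMr// mul1r ltrDl.
Qed.

Lemma clin_small_le T (b r : R) : 0 < r -> 0 <= b ->
  (forall h : X, `|h| < r -> `|T h| <= b * `|h|) -> `|T| <= b.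
Proof.
move=> r0 b0 Tb; apply: clin_norm_le => // x.
have [->|x0] := eqVneq x 0; first by rewrite clin0 !normr0 mulr0.
have nx0 : 0 < `|x| by rewrite normr_gt0.
have [a a0 ax] : exists2 a : R, 0 < a & a * `|x| < r.
  exists (r / 2 / `|x|); first by rewrite !divr_gt0.
  by rewrite divfK ?gt_eqF// ltr_pdivrMr// ltr_pMr// ltr1n.
have := Tb (a *: x); rewrite clinZ !normrZ (gtr0_norm a0) mulrCA ler_pM2l//.
exact.
Qed.

Lemma slip_derivative u y T S b : 0 <= b -> slip u y T b -> has_frechet u y S ->
  `|S - T| <= b.
Proof.
move=> b0 Hu uS; apply/ler_addgt0Pr => e e0.
have e20 : 0 < e / 2 by rewrite divr_gt0.
have [r r0 ur] := Hu _ e20; have [s s0 us] := uS _ e20.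
apply: (@clin_small_le _ _ (Num.min r s)); rewrite ?lt_min ?r0//.
  by rewrite addr_ge0// ltW.
move=> h; rewrite lt_min => /andP[hr hs].
have := ur (y + h) y; have := us (y + h).
rewrite addrC addKr subrr normr0 => /(_ hs) H1 /(_ hr r0) H2.
rewrite clin_subE (_ : _ - _ = (u (y + h) - u y - T h) - (u (y + h) - u y - S h)).
  rewrite (le_trans (ler_normB _ _))// (le_trans (lerD H2 H1))//.
  by rewrite -mulrDl -addrA -splitr.
by lmod.
Qed.

Lemma has_frechet_pointwise u y S b : has_frechet u y S -> `|S| <= b ->
  pointwise_lip u y b.
Proof.
move=> uS Sb e /uS[r r0 ur]; exists r => // z /ur H.
rewrite -[u z - u y](subrK (S (z - y))) (le_trans (ler_normD _ _))//.
by rewrite addrC mulrDl lerD// (le_trans (clin_le _ _))// ler_wpM2r.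
Qed.

(** The zero map [u - u] satisfies [slip] with operator [T - S], and its derivative is 0. *)
Lemma slip_uniq u y T S b c : 0 <= b + c -> slip u y T b -> slip u y S c ->
  `|T - S| <= b + c.
Proof.
move=> bc Hu Hv; have := slipB Hu Hv.
set w := fun x => _; have wy : has_frechet w y 0.
  move=> e e0; exists 1 => // z _.
  by rewrite /w !subrr normr0 mulr_ge0// ltW.
by move=> H; have := slip_derivative bc H wy; rewrite sub0r normrN.
Qed.

(** C^1 maps are strictly differentiable: on a small ball [u] minus its derivative at [y] has
    derivative of norm at most [e], and [ball_lip] applies. *)
Lemma Cfin1_slip U u y : open U -> Cfin 1 U u -> U y ->
  slip u y (frechet u y) 0.
Proof.
move=> oU [du /Cfin0P-/(_ oU) cu] Uy e e0.
have [d d0 ud] := cu y Uy e e0; have [r r0 rU] := open_ball_sub oU Uy.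
exists (Num.min d r); first by rewrite lt_min d0.
set rr := Num.min d r; rewrite add0r.
suff H : lip_on (ball y rr) (fun x => u x - frechet u y x) e.
  move=> x z xr zr; rewrite clinB.
  rewrite (_ : _ - _ = u x - frechet u y x - (u z - frechet u y z)); last by lmod.
  by apply: H; apply/ball_distE.
apply: ball_lip => p; rewrite lt_min => /andP[pd /rU Up].
apply: (@has_frechet_pointwise _ _ (frechet u p - frechet u y)); last exact: ud.
move=> e' e'0; have [s s0 us] := has_frechet_frechet (du p Up) e'0.
exists s => // z zs; rewrite clin_subE.
rewrite (_ : _ - _ = u z - u p - frechet u p (z - p)); first exact: us.
by rewrite !clinB; lmod.
Qed.

End lipschitz.

(** * Truncated distances and approximation on balls *)

Section truncated_distance.
Context {R : realType} {X : normedModType R}.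
Implicit Types (V : set X).

(* The truncation makes [tdist set0] equal to 1 rather than to the junk value
   of the infimum of the empty set. *)
Definition tdist V (x : X) : R :=
  inf [set t | t = 1 \/ exists2 v, V v & t = `|x - v|].

Let dset V x := [set t | t = 1 \/ exists2 v, V v & t = `|x - v|].

Let dset_inf V x : has_inf (dset V x).
Proof.
split; first by exists 1; left.
by exists 0 => _ [->|[v _ ->]].
Qed.

Lemma tdist_le V x v : V v -> tdist V x <= `|x - v|.
Proof. by move=> Vv; apply: ge_inf; [exact: (dset_inf V x).2|right; exists v]. Qed.

Lemma tdist_le1 V x : tdist V x <= 1.
Proof. by apply: ge_inf; [exact: (dset_inf V x).2|left]. Qed.

Lemma tdist_glb V x e : e <= 1 -> (forall v, V v -> e <= `|x - v|) -> e <= tdist V x.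
Proof.
move=> e1 H; apply: lb_le_inf; first exact: (dset_inf V x).1.
by move=> _ [->//|[v Vv ->]]; exact: H.
Qed.

Lemma tdist_ge0 V x : 0 <= tdist V x.
Proof. by apply: tdist_glb => // v _. Qed.

Lemma tdist_lip1 V x y : tdist V x <= tdist V y + `|x - y|.
Proof.
rewrite -lerBlDr; apply: tdist_glb.
  by rewrite (le_trans _ (tdist_le1 V x))// gerBl.
move=> v Vv; rewrite lerBlDr (le_trans (tdist_le x Vv))//.
by rewrite [leRHS]addrC ler_distD.
Qed.

Lemma tdist_lip V x y : `|tdist V x - tdist V y| <= `|x - y|.
Proof.
have H1 := tdist_lip1 V x y; have := tdist_lip1 V y x; rewrite (distrC y) => H2.
by rewrite ler_norml; apply/andP; split; lra.
Qed.

Lemma tdist_gt0 V x r : 0 < r -> (forall v, V v -> r <= `|x - v|) -> 0 < tdist V x.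
Proof.
move=> r0 H; apply: (@lt_le_trans _ _ (Num.min r 1)); first by rewrite lt_min r0 ltr01.
apply: tdist_glb => [|v Vv]; first by rewrite ge_min lexx orbT.
by rewrite ge_min H.
Qed.

Lemma tdist_compl_gt0 U x : open U -> U x -> 0 < tdist (~` U) x.
Proof.
move=> oU Ux; have [r r0 rU] := open_ball_sub oU Ux.
apply: (tdist_gt0 r0) => v nUv; rewrite leNgt; apply/negP => vr.
by apply: nUv; apply: rU; rewrite distrC.
Qed.

Lemma tdist_compl_ball U x z : `|z - x| < tdist (~` U) x -> U z.
Proof.
move=> H; apply: contrapT => nUz; move: H; apply/negP; rewrite -leNgt distrC.
exact: tdist_le.
Qed.

Lemma tdist_eq0 V x : V x -> tdist V x = 0.
Proof.
move=> Vx; apply/eqP; rewrite eq_le tdist_ge0 andbT.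
by have := tdist_le x Vx; rewrite subrr normr0.
Qed.

End truncated_distance.

Section approximation_on_balls.
Context {R : realType} {X : normedModType R}.

(** Rescaling to the unit ball multiplies Lipschitz constants by [rho] and rescaling back divides by
    it, so [C] is unchanged. *)
Lemma LA_on_ball {Y : normedModType R} k (C : R) : property_LA_with X Y k C ->
  forall (c : X) (rho M : R) (f : X -> Y), 0 < rho -> 0 <= M ->
  lip_on (ball c rho) f M -> forall e, 0 < e ->
  exists g : X -> Y, [/\ lip_on (ball c rho) g (C * M),
    Csmooth k (ball c rho) g & forall x, ball c rho x -> `|f x - g x| <= e].
Proof.
move=> [C0 hLA] c rho M f rho0 M0 fM e e0.
have in_ball x : ball c rho x -> ball 0 1 (rho^-1 *: (x - c)).
  move=> /ball_distE xr; apply/ball_distE; rewrite subr0 normrZ gtr0_norm ?invr_gt0//.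
  by rewrite mulrC ltr_pdivrMr// mul1r.
have [||g [gM cg fg]] := hLA (M * rho) (fun u => f (c + rho *: u)) _ _ e e0.
- by rewrite mulr_ge0// ltW.
- apply/lip_onP => x y /ball_distE xr /ball_distE yr.
  have H z : `|z - 0| < 1 -> ball c rho (c + rho *: z).
    rewrite subr0 => z1; apply/ball_distE; rewrite addrC addKr normrZ gtr0_norm//.
    by rewrite gtr_pMr.
  apply: (le_trans (fM _ _ (H _ xr) (H _ yr))).
  rewrite (_ : _ - _ = rho *: (x - y)); last by lmod.
  by rewrite normrZ gtr0_norm// mulrA.
exists (fun x => g (rho^-1 *: (x - c))); split.
- move=> x y xr yr; have /lip_onP H := gM.
  apply: (le_trans (H _ _ (in_ball _ xr) (in_ball _ yr))).
  rewrite (_ : _ - _ = rho^-1 *: (x - y)); last by lmod.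
  rewrite normrZ gtr0_norm ?invr_gt0// !mulrA ler_wpM2r//.
  by rewrite mulfK// gt_eqF.
- by apply: (@Csmooth_affine _ _ _ _ _ (ball 0 1)) => //; exact: ball_open.
- move=> x /in_ball H; have := fg _ H.
  by rewrite scalerA divff ?gt_eqF// scale1r [c + _]addrC subrK.
Qed.

(** Approximate [f] times [y0] as a map into [Y], then apply the functional [l] divided by
    [l y0]. *)
Lemma LA_scalar {Y : normedModType R} k (y0 : Y) : y0 != 0 ->
  property_LA X Y k -> property_LA X R k.
Proof.
move=> y00 [C [C0 hLA]]; have [l ly0] := nonzero_functional y00.
have nl0 : 0 < `|l y0| by rewrite normr_gt0.
exists (`|l| * C * `|y0| / `|l y0|); split; first by rewrite !mulr_ge0// invr_ge0.
move=> L f L0 fL e e0.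
pose e1 := e * `|l y0| / (`|l| + 1).
have l10 : 0 < `|l| + 1 by rewrite ltr_wpDl.
have e10 : 0 < e1 by rewrite divr_gt0// mulr_gt0.
have [||g [gM cg fg]] := hLA (L * `|y0|) (fun u => f u *: y0) _ _ e1 e10.
- by rewrite mulr_ge0.
- apply/lip_onP => x y xr yr; have /lip_onP H := fL.
  by rewrite -scalerBl normrZ mulrAC ler_wpM2r// H.
have inv_norm : `|(l y0)^-1| = `|l y0|^-1 by rewrite normfV.
exists (fun x => (l y0)^-1 *: l (g x)); split.
- apply/lip_onP => x y xr yr; have /lip_onP H := gM.
  rewrite -scalerBr -clinB normrZ inv_norm.
  apply: (@le_trans _ _ (`|l y0|^-1 * (`|l| * (C * (L * `|y0|) * `|x - y|)))).
    by rewrite ler_wpM2l ?invr_ge0// (le_trans (clin_le _ _))// ler_wpM2l// H.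
  by rewrite le_eqVlt; apply/orP; left; apply/eqP; ring.
- by apply: CsmoothZ; [exact: ball_open|apply: Csmooth_postcomp => //; exact: ball_open].
- move=> x xr.
  rewrite (_ : _ - _ = (l y0)^-1 * l (f x *: y0 - g x)); last first.
    rewrite clinB clinZ mulrBr [_ *: l y0]/(_ * _) [_ *: l (g x)]/(_ * _).
    by rewrite mulrCA mulVf// mulr1.
  rewrite normrM inv_norm ler_pdivrMl// mulrC.
  rewrite (le_trans (clin_le _ _))//.
  apply: (@le_trans _ _ (`|l| * e1)); first by rewrite ler_wpM2l// fg.
  have := normr_ge0 l; rewrite /e1 mulrA ler_pdivrMr// => nl.
  by nra.
Qed.

End approximation_on_balls.

(** * Sigma-discrete step functions *)

Section step_functions.
Context {R : realType} {X : normedModType R}.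

(** The strict part of a well-ordering. Least elements of singletons give reflexivity, and for pairs
    existence gives totality and uniqueness gives antisymmetry. *)
Lemma well_ordered_relation (T : eqType) : exists lt : T -> T -> Prop,
  (forall b c, b <> c -> lt b c \/ lt c b) /\
  forall A : set T, A !=set0 -> exists c, A c /\ forall b, A b -> ~ lt b c.
Proof.
have [r wo] := wochoice.well_ordering_principle T.
have anti b c : r b c -> r c b -> b = c.
  move=> bc cb; have refl x : r x x.
    have [|z [[zx zlb] _]] := wo [pred y | y == x]; first by exists x; rewrite inE.
    by move: zx zlb; rewrite inE => /eqP-> /(_ x); rewrite inE eqxx; apply.
  have [|z [_ zu]] := wo [pred y | (y == b) || (y == c)].
    by exists b; rewrite inE eqxx.
  transitivity z; [symmetry|]; apply: zu; split; rewrite ?inE ?eqxx ?orbT//.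
    by move=> y; rewrite inE => /orP[/eqP->|/eqP->].
  by move=> y; rewrite inE => /orP[/eqP->|/eqP->].
exists (fun b c => r b c /\ b <> c); split.
  move=> b c bc.
  have [|z [[zbc zlb] _]] := wo [pred y | (y == b) || (y == c)].
    by exists b; rewrite inE eqxx.
  have zb : r z b by apply: zlb; rewrite inE eqxx.
  have zc : r z c by apply: zlb; rewrite inE eqxx orbT.
  move: zbc; rewrite inE => /orP[/eqP zE|/eqP zE]; rewrite zE in zb zc.
    by left.
  by right; split; [exact: zb|move=> cb; apply: bc; rewrite cb].
move=> A [a Aa].
have [|c [[cA clb] _]] := wo [pred y | `[< A y >]].
  by exists a; apply/asboolP.
exists c; split; first exact/asboolP/cA.
move=> b Ab [bc]; apply; apply: anti => //.
by apply: clb; apply/asboolP.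
Qed.

(** A sequence of bump layers subordinate to the balls of centre [c] and radius [rho c]. On each
    ball of radius [q n] the layer [psi n] either vanishes or is attached to a single centre,
    recorded by [cen n]. The condition [sf_cover] replaces local finiteness: where [psi n] is 1, the
    weight [1 - psi n] of all later layers vanishes. *)
Record step_functions (k : option nat) (U : set X) (rho : X -> R)
    (psi : nat -> X -> R) (cen : nat -> X -> X) (q M : nat -> R) : Prop := {
  sf_radius : forall n, 0 < q n ;
  sf_const : forall n, 0 <= M n ;
  sf_01 : forall n x, 0 <= psi n x <= 1 ;
  sf_local : forall n y, (forall x, `|x - y| < q n -> psi n x = 0) \/
     exists2 c, U c & forall x, `|x - y| < q n -> `|x - c| < rho c /\ cen n x = c ;
  sf_smooth : forall n y, Csmooth k (ball y (q n)) (psi n) ;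
  sf_lip : forall n y, lip_on (ball y (q n)) (psi n) (M n) ;
  sf_cover : forall x, U x -> exists n, (forall z, `|z - x| < q n -> psi n z = 1) }.

(** The bump around [V c] is [step (g c / (2 q))], where [g c] is smooth and within [q] of the
    distance to [V c]. Within [q] of [V c] the argument of [step] is at most 1, and at distance
    [5 q] or more it is at least 2. The neighbourhoods [E c] of width [7 q] are disjoint by the
    separation. A ball of radius [q] whose centre is within [6 q] of [V c] lies in [E c]; if there
    is no such [c], its points are [5 q] away from every [V c], so the bump is already 0 there. *)
Lemma separated_layer k (C : R) (U : set X) (rho : X -> R) (V : X -> set X) (q : R) :
  property_LA_with X R k C -> 0 < q -> 16 * q <= 1 ->
  (forall c, U c -> 0 < rho c) ->
  (forall c v, V c v -> U c) ->
  (forall c v z, V c v -> `|z - v| < 16 * q -> `|z - c| < rho c) ->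
  (forall b c v w, V b v -> V c w -> b <> c -> 16 * q <= `|v - w|) ->
  exists (psi : X -> R) (cen : X -> X), [/\ forall x, 0 <= psi x <= 1 ,
    forall y, (forall x, `|x - y| < q -> psi x = 0) \/
     exists2 c, U c & forall x, `|x - y| < q -> `|x - c| < rho c /\ cen x = c ,
    forall y, Csmooth k (ball y q) psi,
    forall y, lip_on (ball y q) psi (step_lip * (C / (2 * q))) &
    forall c v z, V c v -> `|z - v| < q -> psi z = 1].
Proof.
move=> hLA q0 q1 rho0 VU Vball Vsep.
have C0 := hLA.1.
have /choice[g gP] c : exists g : X -> R, U c ->
    [/\ lip_on (ball c (rho c)) g C, Csmooth k (ball c (rho c)) g &
       forall x, ball c (rho c) x -> `|tdist (V c) x - g x| <= q].
  have [Uc|nUc] := pselect (U c); last by exists (fun=> 0).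
  have lipV : lip_on (ball c (rho c)) (tdist (V c) : X -> R) 1.
    by move=> x y _ _; rewrite mul1r; exact: tdist_lip.
  have [g gP] := LA_on_ball hLA (rho0 _ Uc) ler01 lipV q0.
  by exists g => _; rewrite mulr1 in gP.
pose E c x := exists2 v, V c v & `|x - v| < 7 * q.
have Euniq b c x : E b x -> E c x -> b = c.
  move=> [v Vv xv] [w Vw xw]; apply: contrapT => /(Vsep _ _ _ _ Vv Vw).
  apply/negP; rewrite -ltNge.
  have := ler_distD x v w; rewrite (distrC v x) => H.
  by apply: (le_lt_trans H); apply: (lt_trans (ltrD xv xw)); lra.
have Eball c x : E c x -> ball c (rho c) x.
  move=> [v Vv xv]; apply/ball_distE; apply: (Vball _ _ _ Vv).
  by apply: (lt_trans xv); lra.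
have EU c x : E c x -> U c by move=> [v /VU].
pose cen x := xget 0 [set c | E c x].
have cenE c x : E c x -> cen x = c.
  move=> Ec; apply: (@Euniq _ _ x) => //.
  by apply: (@xgetPex _ 0 [set c | E c x]); exists c.
(* If no [E c] contains [x], then [cen x] is the default 0, the test fails and [psi x] is 0. *)
pose psi x := if `[< E (cen x) x >] then step (g (cen x) x / (2 * q)) else 0.
have psiE c x : E c x -> psi x = step (g c x / (2 * q)).
  by move=> Ec; rewrite /psi (cenE _ _ Ec) ifT//; apply/asboolP.
have q20 : 0 < 2 * q by rewrite mulr_gt0.
have loc y : (forall x, `|x - y| < q -> psi x = 0) \/
    exists2 c, U c & forall x, `|x - y| < q -> E c x.
  have [[c [v Vv yv]]|nE] := pselect (exists c, exists2 v, V c v & `|y - v| < 6 * q).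
    right; exists c; first exact: VU Vv.
    move=> x xy; exists v => //; have := ler_distD y x v => H.
    by apply: (le_lt_trans H); apply: (lt_le_trans (ltrD xy yv)); lra.
  left => x xy; rewrite /psi; case: ifPn => // /asboolP Ex.
  set c := cen x in Ex *.
  have [_ _ gq] := gP c (EU _ _ Ex).
  apply: step_eq0; rewrite ler_pdivlMr//.
  have := gq _ (Eball _ _ Ex); rewrite ler_norml => /andP[_ H].
  suff : 5 * q <= tdist (V c) x by move=> H2; lra.
  apply: tdist_glb; first lra.
  move=> v Vv; rewrite leNgt; apply/negP => xv; apply: nE; exists c, v => //.
  have := ler_distD x y v; rewrite (distrC y x) => H3.
  by apply: (le_lt_trans H3); apply: (lt_le_trans (ltrD xy xv)); lra.
have B0 : 0 <= step_lip :> R.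
  by rewrite /step_lip divr_ge0// exprn_ge0// flat_ge0.
exists psi, cen; split.
- move=> x; rewrite /psi; case: ifP => _; first exact: step01.
  by rewrite lexx ler01.
- move=> y; have [H|[c Uc Ec]] := loc y; [by left|right].
  exists c => // x /Ec Ecx; split; last exact: cenE.
  by apply/ball_distE; exact: Eball.
- move=> y; have [H|[c Uc Ec]] := loc y.
    apply: (@Csmooth_ext _ _ _ _ _ (fun=> 0)) => //; first exact: ball_open.
      by move=> x /ball_distE/H.
    by apply: Csmooth_cst; exact: ball_open.
  have [_ cg _] := gP c Uc.
  apply: (@Csmooth_ext _ _ _ _ _ (fun x => step ((2 * q)^-1 *: g c x))).
  + exact: ball_open.
  + by move=> x /ball_distE/Ec/psiE ->; rewrite [g c x / _]mulrC.
  + apply: Csmooth_step; first exact: ball_open.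
    apply: CsmoothZ; first exact: ball_open.
    apply: (Csmooth_sub _ _ _ cg); [exact: ball_open|exact: ball_open|].
    by move=> x /ball_distE/Ec; exact: Eball.
- move=> y x z /ball_distE xr /ball_distE zr; have [H|[c Uc Ec]] := loc y.
    rewrite !H// subrr normr0 mulr_ge0// mulr_ge0// divr_ge0// ltW//.
  rewrite !(psiE c); [|exact: Ec|exact: Ec].
  apply: (le_trans (step_lipP _ _)); rewrite -mulrA ler_wpM2l//.
  rewrite -mulrBl normrM normfV (gtr0_norm q20) [leRHS]mulrAC.
  apply: ler_wpM2r; first by rewrite invr_ge0 ltW.
  by have [gM _ _] := gP c Uc; apply: gM; apply: Eball; exact: Ec.
- move=> c v z Vv zv.
  have Ec : E c z by exists v => //; apply: (lt_trans zv); lra.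
  rewrite (psiE c)//; apply: step_eq1; rewrite ler_pdivrMr// mul1r.
  have [_ _ gq] := gP c (VU _ _ Vv).
  have := gq _ (Eball _ _ Ec); rewrite ler_norml => /andP[H _].
  have H2 := tdist_le z Vv; lra.
Qed.

(** The construction follows M. E. Rudin's proof of Stone's theorem that metric spaces are
    paracompact, with the centres well-ordered. *)
Lemma step_functions_exist k (C : R) (U : set X) (rho : X -> R) :
  property_LA_with X R k C -> (forall c, U c -> 0 < rho c) ->
  exists psi cen q M, step_functions k U rho psi cen q M.
Proof.
move=> hLA rho0; have [lt [lt_total lt_wf]] := well_ordered_relation X.
pose r n : R := n.+1%:R^-1.
have r0 n : 0 < r n by rewrite invr_gt0 ltr0n.
have r1 n : r n <= 1 by rewrite invf_le1 ?ltr0n// ler1n.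
pose V n c := [set x | [/\ U c, forall z, `|z - x| < r n -> `|z - c| < rho c &
   forall b, U b -> lt b c -> ~ `|x - b| < rho b]].
pose q n : R := r n / 16.
have q0 n : 0 < q n by rewrite divr_gt0.
have qE n : 16 * q n = r n by rewrite /q mulrCA divff ?mulr1.
(* The ball of radius [r n] about [v] lies in the ball of [b], which [w] avoids because [b] precedes
   [c]. *)
have sep n b c v w : V n b v -> V n c w -> lt b c -> r n <= `|v - w|.
  move=> [Ub vb _] [Uc _ wb] bc; rewrite leNgt; apply/negP => vw.
  by apply: (wb b Ub bc); apply: vb; rewrite distrC.
have /choice[pc pcP] n : exists pc : (X -> R) * (X -> X), [/\ forall x, 0 <= pc.1 x <= 1 ,
    forall y, (forall x, `|x - y| < q n -> pc.1 x = 0) \/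
     exists2 c, U c & forall x, `|x - y| < q n -> `|x - c| < rho c /\ pc.2 x = c ,
    forall y, Csmooth k (ball y (q n)) pc.1,
    forall y, lip_on (ball y (q n)) pc.1 (step_lip * (C / (2 * q n))) &
    forall c v z, V n c v -> `|z - v| < q n -> pc.1 z = 1].
  have [||||psi [cen H]] := @separated_layer k C U rho (V n) (q n) hLA (q0 n) _ rho0.
  - by rewrite qE.
  - by move=> c v [].
  - by rewrite qE => c v z [_ H _]; exact: H.
  - rewrite qE => b c v w Vb Vc bc; have [lbc|lcb] := lt_total _ _ bc.
      exact: sep Vb Vc lbc.
    by rewrite distrC; exact: sep Vc Vb lcb.
  by exists (psi, cen).
exists (fun n => (pc n).1), (fun n => (pc n).2), q,
   (fun n => step_lip * (C / (2 * q n))); split.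
- exact: q0.
- move=> n; rewrite mulr_ge0//.
    by rewrite /step_lip divr_ge0// exprn_ge0// flat_ge0.
  by rewrite divr_ge0 ?hLA.1// mulr_ge0// ltW.
- by move=> n; have [] := pcP n.
- by move=> n; have [] := pcP n.
- by move=> n; have [] := pcP n.
- by move=> n; have [] := pcP n.
move=> x Ux.
(* Take the first centre [c] whose ball contains [x]; then [x] lies in [V n c] as soon as [r n] is
   at most the remaining room [rho c - |x - c|]. *)
have [|c [[Uc xc] cmin]] := lt_wf [set c | U c /\ `|x - c| < rho c].
  by exists x; split => //; rewrite subrr normr0; exact: rho0.
have [n rn] : exists n, r n <= rho c - `|x - c|.
  have d0 : 0 < rho c - `|x - c| by rewrite subr_gt0.
  exists (Num.bound (rho c - `|x - c|)^-1).
  rewrite /r -[leRHS]invrK lef_pV2 ?posrE ?invr_gt0 ?ltr0n//.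
  have dV0 : 0 <= (rho c - `|x - c|)^-1 by rewrite invr_ge0 ltW.
  by rewrite ltW// (lt_trans (archi_boundP dV0))// ltr_nat.
exists n; have [_ _ _ _ H] := pcP n; move=> z0 zx0; apply: (H c x z0) => //.
split => // [z zx|b Ub bc xb].
  rewrite -(subrK x z) -addrA (le_lt_trans (ler_normD _ _))//.
  by rewrite -ltrBrDr (lt_le_trans zx).
by apply: (cmin b) => //; split.
Qed.

End step_functions.

(** * Gluing *)

Section gluing.
Context {R : realType} {X Y : normedModType R}.
Variables (k : option nat) (U : set X) (rho : X -> R).
Variables (psi : nat -> X -> R) (cen : nat -> X -> X) (q M : nat -> R).
Hypothesis sf : step_functions k U rho psi cen q M.
Variable h : nat -> X -> X -> Y.

(** The nested combination [psi_n h_n + (1 - psi_n) (psi_(n+1) h_(n+1) + ...)], truncated so that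
    layer [n + m] enters with inner weight 1. *)
Fixpoint glue_from (m n : nat) (x : X) : Y :=
  if m is m'.+1 then
    psi n x *: h n (cen n x) x + (1 - psi n x) *: glue_from m' n.+1 x
  else h n (cen n x) x.

(** Any index provided by [sf_cover] serves: truncating at a layer where [psi] is 1 changes nothing,
    as [glue_from_stable] shows. *)
Definition stop_index (x : X) : nat :=
  xget 0%N [set n | forall z, `|z - x| < q n -> psi n z = 1].

Definition glued (x : X) : Y := glue_from (stop_index x) 0 x.

Lemma glue_from_stable j : forall m n x, psi (n + j)%N x = 1 -> (j <= m)%N ->
  glue_from m n x = glue_from j n x.
Proof.
elim: j => [|j IH] [|m] n x //=; rewrite ?addn0 ?addnS => px jm.
  by rewrite px subrr scale0r addr0 scale1r.
by rewrite IH.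
Qed.

Lemma stop_indexP x : U x -> forall z, `|z - x| < q (stop_index x) ->
  psi (stop_index x) z = 1.
Proof.
move=> Ux; have [n nP] := sf_cover sf Ux.
exact: (@xgetPex _ 0%N [set n | forall z, `|z - x| < q n -> psi n z = 1] (ex_intro _ n nP)).
Qed.

Lemma glue_near y z : U y -> U z -> `|z - y| < q (stop_index y) ->
  glued z = glue_from (stop_index y) 0 z.
Proof.
move=> Uy Uz zy; have p1 := stop_indexP Uy zy.
have p2 : psi (stop_index z) z = 1.
  by apply: stop_indexP => //; rewrite subrr normr0; exact: (sf_radius sf).
rewrite /glued; have [le|/ltnW le] := leqP (stop_index y) (stop_index z).
  exact: glue_from_stable.
exact/esym/glue_from_stable.
Qed.

(** Backward induction from the stopping layer of [y] to layer 0, for a property [P n] of germs at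
    [y]. The index lets bounds depend on the layer; the last premise covers layers that vanish near
    [y]. *)
Lemma glue_ind y (P : nat -> (X -> Y) -> Prop) : open U -> U y ->
  (forall n u v r, 0 < r -> (forall z, `|z - y| < r -> u z = v z) ->
     P n u -> P n v) ->
  (forall n c, U c -> `|y - c| < rho c -> P n (h n c)) ->
  (forall n c u, U c -> `|y - c| < rho c -> P n.+1 u ->
     P n (fun x => psi n x *: h n c x + (1 - psi n x) *: u x)) ->
  (forall n u, P n.+1 u -> P n u) -> P 0%N glued.
Proof.
move=> oU Uy Pgerm Pbase Pstep Pskip.
have yy n : `|y - y| < q n by rewrite subrr normr0; exact: (sf_radius sf).
have H m n : psi (n + m)%N y = 1 -> P n (glue_from m n).
  elim: m n => [|m IH] n.
    rewrite addn0 => p1; have [p0|[c Uc cP]] := sf_local sf n y.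
      by have := p0 y (yy n); rewrite p1 => /eqP; rewrite oner_eq0.
    apply: (Pgerm n (h n c) _ (q n)); first exact: (sf_radius sf).
      by move=> z /cP[_ /= ->].
    by apply: Pbase => //; have [] := cP y (yy n).
  rewrite addnS -addSn => /IH{}IH; have [p0|[c Uc cP]] := sf_local sf n y.
    apply: (Pgerm n (glue_from m n.+1) _ (q n)); first exact: (sf_radius sf).
      by move=> z /p0 /= ->; rewrite scale0r add0r subr0 scale1r.
    exact: Pskip.
  apply: (Pgerm n (fun x => psi n x *: h n c x + (1 - psi n x) *: glue_from m n.+1 x)
     _ (q n)); first exact: (sf_radius sf).
    by move=> z /cP[_ /= ->].
  by apply: Pstep => //; have [] := cP y (yy n).
have [r r0 rU] := open_ball_sub oU Uy.
apply: (Pgerm 0%N (glue_from (stop_index y) 0) _ (Num.min r (q (stop_index y)))).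
- by rewrite lt_min r0; exact: (sf_radius sf).
- by move=> z; rewrite lt_min => /andP[/rU Uz zy]; apply/esym/glue_near.
- by apply: H; apply: stop_indexP.
Qed.

End gluing.

(** * Gluing of C^k approximations with control of derivatives *)

Section smooth_gluing.
Context {R : realType} {X Y : normedModType R}.

(** Two pieces with errors at most [w n] differ by at most [2 w n], which the [n]-th partition
    function multiplies by [M n]. The products must be summable, and [D n] contains all earlier
    [M i] to make [w] nonincreasing. *)
Lemma small_weights (M : nat -> R) : (forall n, 0 <= M n) ->
  exists w : nat -> R, [/\ forall n, 0 < w n, forall n, w n <= 1,
    forall n, w n.+1 <= w n & forall n, M n * (w n *+ 2) <= 2 ^- n.+1].
Proof.
move=> M0; pose D n : R := 1 + \sum_(i < n.+1) M i.
have DS n : D n.+1 = D n + M n.+1 by rewrite /D big_ord_recr/= addrA.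
have D1 n : 1 <= D n by rewrite /D lerDl sumr_ge0.
have D0 n : 0 < D n by apply: lt_le_trans (D1 n).
have MD n : M n <= D n.
  by rewrite /D big_ord_recr/= addrA lerDr addr_ge0// sumr_ge0.
pose w n : R := (2 ^+ n.+2 * D n)^-1.
have p0 n : 0 < (2 : R) ^+ n by rewrite exprn_gt0.
have wd0 n : 0 < 2 ^+ n.+2 * D n by rewrite mulr_gt0.
exists w; split => n.
- by rewrite invr_gt0.
- rewrite invf_le1//; apply: (le_trans (D1 n)); apply: ler_peMl; first exact: ltW.
  by apply: exprn_ege1; rewrite ler1n.
- rewrite lef_pV2 ?posrE//; apply: ler_pM; [exact: ltW|exact: ltW| |].
    by rewrite [leRHS]exprS; apply: ler_peMl; [exact: ltW|rewrite ler1n].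
  by rewrite DS lerDl.
- have := p0 n.+1; rewrite /w [2 ^+ n.+2]exprS [_ *+ 2]mulr2n.
  set p := (2 : R) ^+ n.+1 => pp; have Dn0 := D0 n.
  rewrite (_ : M n * _ = p^-1 * (M n / D n)); last by field; rewrite !gt_eqF.
  by apply: ler_piMr; rewrite ?invr_ge0 ?(ltW pp)// ler_pdivrMr// mul1r.
Qed.

(** Local pieces are available with arbitrarily small error [eta] on a ball that does not depend on
    [eta]. The balls thus fix the partition and its constants [M n], and the accuracies are chosen
    afterwards. All estimates concern one point at a time, so [T] and [b] may jump. *)
Theorem smooth_gluing k (C : R) (U : set X) (F : X -> Y) (T : X -> 'L(X, Y))
    (b eps : X -> R) : open U -> property_LA_with X R k C ->
  (forall x, U x -> 0 <= b x) ->
  (forall c, U c -> exists rho e, [/\ 0 < rho, 0 < e,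
    forall x, `|x - c| < rho -> U x /\ e <= eps x &
    forall eta, 0 < eta -> exists h : X -> Y, Csmooth k (ball c rho) h /\
      forall x, `|x - c| < rho -> `|h x - F x| <= eta /\ slip h x (T x) (b x)]) ->
  exists H : X -> Y, Csmooth k U H /\
    forall x, U x -> `|H x - F x| <= eps x /\ slip H x (T x) (b x + eps x).
Proof.
move=> oU hLA b0 loc.
have /choice[re reP] c : exists re : R * R, U c -> [/\ 0 < re.1, 0 < re.2,
    forall x, `|x - c| < re.1 -> U x /\ re.2 <= eps x &
    forall eta, 0 < eta -> exists h : X -> Y, Csmooth k (ball c re.1) h /\
      forall x, `|x - c| < re.1 -> `|h x - F x| <= eta /\ slip h x (T x) (b x)].
  have [/loc[r [e H]]|nU] := pselect (U c); first by exists (r, e).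
  by exists (0, 0).
have [psi [cen [q [M sf]]]] := @step_functions_exist _ _ _ _ U (fun c => (re c).1)
  hLA (fun c Uc => let: And4 r0 _ _ _ := reP c Uc in r0).
have [w [w0 w1 wS Mw]] := small_weights (sf_const sf).
have /choice[h0 h0P] (nc : nat * X) : exists h : X -> Y, U nc.2 ->
    Csmooth k (ball nc.2 (re nc.2).1) h /\ forall x, `|x - nc.2| < (re nc.2).1 ->
      `|h x - F x| <= (re nc.2).2 * w nc.1 /\ slip h x (T x) (b x).
  have [Uc|nU] := pselect (U nc.2); last by exists (fun=> 0).
  have [_ e0 _ H] := reP _ Uc.
  by have [|h hP] := H ((re nc.2).2 * w nc.1); [rewrite mulr_gt0|exists h].
pose h n c := h0 (n, c).
have hs n c : U c -> Csmooth k (ball c (re c).1) (h n c) by case/(h0P (n, c)).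
have hF n c x : U c -> `|x - c| < (re c).1 -> `|h n c x - F x| <= eps x * w n.
  move=> Uc xc; have [_ /(_ _ xc)[H _]] := h0P (n, c) Uc.
  apply: (le_trans H); rewrite ler_wpM2r ?(ltW (w0 n))//.
  by have [_ _ /(_ _ xc)[]] := reP c Uc.
have hT n c x : U c -> `|x - c| < (re c).1 -> slip (h n c) x (T x) (b x).
  by move=> Uc xc; have [_ /(_ _ xc)[_]] := h0P (n, c) Uc.
exists (glued psi cen q h).
have eps0 x : U x -> 0 < eps x.
  move=> Ux; have [r0 e0 H _] := reP x Ux; apply: (lt_le_trans e0).
  by apply: (H x _).2; rewrite subrr normr0.
have key y : U y -> (exists2 r, 0 < r & Csmooth k (ball y r) (glued psi cen q h)) /\
    `|glued psi cen q h y - F y| <= eps y * w 0%N /\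
    slip (glued psi cen q h) y (T y) (b y + eps y * 2 ^- 0).
  (* The part of the combination from layer [n] on has error at most [eps y * w n] and excess slope
     at most [eps y * 2^-n]. Half of the latter is inherited from layer [n + 1]; the other half pays
     for the slope of [psi n]. *)
  move=> Uy; apply: (glue_ind sf (h := h) (y := y) (P := fun n u =>
     (exists2 r, 0 < r & Csmooth k (ball y r) u) /\
     `|u y - F y| <= eps y * w n /\ slip u y (T y) (b y + eps y * 2 ^- n))) => //.
  - move=> n u v r r0 uv [[s s0 cu] [uF uT]]; split; last split.
    + exists (Num.min r s); first by rewrite lt_min r0.
      apply: (@Csmooth_ext _ _ _ _ _ u); first exact: ball_open.
        by move=> z /ball_distE; rewrite lt_min => /andP[/uv].
      apply: (Csmooth_sub _ _ _ cu); [exact: ball_open|exact: ball_open|].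
      by apply: le_ball; rewrite ge_min lexx orbT.
    + by rewrite -uv// subrr normr0.
    + exact: (slip_near_eq r0 uv).
  - move=> n c Uc yc; split; last split.
    + have [|r r0 H] := @open_ball_sub _ _ (ball c (re c).1) y (ball_open _ _).
        exact/ball_distE.
      exists r => //; apply: (Csmooth_sub _ _ _ (hs n c Uc)); try exact: ball_open.
      by move=> z /ball_distE/H.
    + exact: hF.
    + apply: (slip_le _ (hT n c y Uc yc)).
      by rewrite lerDl mulr_ge0 ?invr_ge0 ?exprn_ge0// ltW// eps0.
  - move=> n c u Uc yc [[s s0 cu] [uF uT]].
    have /andP[p0 p1] := sf_01 sf n y; split; last split.
    + have [|r r0 H] := @open_ball_sub _ _ (ball c (re c).1) y (ball_open _ _).
        exact/ball_distE.
      pose t := Num.min (Num.min r s) (q n).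
      have [tr [ts tq]] : t <= r /\ t <= s /\ t <= q n.
        by rewrite /t !ge_min !lexx !orbT.
      have ob := ball_open y t.
      have cp : Csmooth k (ball y t) (psi n).
        apply: (Csmooth_sub _ _ _ (sf_smooth sf n y)); try exact: ball_open.
        exact: le_ball.
      exists t; first by rewrite /t !lt_min r0 s0; exact: (sf_radius sf).
      apply: CsmoothD => //; apply: Csmooth_scale => //.
      * apply: (Csmooth_sub _ _ _ (hs n c Uc)); try exact: ball_open.
        by move=> z /ball_distE zt; apply: H; apply: lt_le_trans tr.
      * by apply: CsmoothB => //; exact: Csmooth_cst.
      * by apply: (Csmooth_sub _ _ _ cu); try exact: ball_open; exact: le_ball.
    + rewrite (_ : _ - _ = psi n y *: (h n c y - F y) + (1 - psi n y) *: (u y - F y)).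
        rewrite (le_trans (ler_normD _ _))// !normrZ (ger0_norm p0).
        rewrite ger0_norm ?subr_ge0//.
        have H1 := hF n c y Uc yc.
        have H2 : `|u y - F y| <= eps y * w n.
          by apply: (le_trans uF); rewrite ler_wpM2l// ltW// eps0.
        have H3 : psi n y * `|h n c y - F y| <= psi n y * (eps y * w n).
          by rewrite ler_wpM2l.
        have H4 : (1 - psi n y) * `|u y - F y| <= (1 - psi n y) * (eps y * w n).
          by rewrite ler_wpM2l// subr_ge0.
        by apply: (le_trans (lerD H3 H4)); rewrite -mulrDl addrC subrK mul1r.
      by lmod.
    + have d2 : `|h n c y - u y| <= eps y * (w n *+ 2).
        rewrite (_ : _ - _ = (h n c y - F y) - (u y - F y)); last by lmod.
        rewrite (le_trans (ler_normB _ _))// mulrnAr mulr2n lerD ?hF//.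
        by apply: (le_trans uF); rewrite ler_wpM2l// ltW// eps0.
      have hT' : slip (h n c) y (T y) (b y + eps y * 2 ^- n.+1).
        apply: (slip_le _ (hT n c y Uc yc)).
        by rewrite lerDl mulr_ge0 ?invr_ge0 ?exprn_ge0// ltW// eps0.
      have pM x z : `|x - y| < q n -> `|z - y| < q n ->
          `|psi n x - psi n z| <= M n * `|x - z|.
        move=> xy zy; exact: (sf_lip sf (proj2 (ball_distE _ _ _) xy) (proj2 (ball_distE _ _ _) zy)).
      have := slip_combine (sf_radius sf n) (sf_const sf n) (sf_01 sf n) pM hT' uT d2.
      apply: slip_le; rewrite -addrA lerD2l mulrCA -mulrDr ler_wpM2l//.
        by rewrite ltW// eps0.
      rewrite (_ : 2 ^- n = 2 ^- n.+1 + 2 ^- n.+1); first by rewrite lerD2l Mw.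
      by rewrite exprS; field; rewrite expf_neq0.
  - move=> n u [cu [uF uT]]; split => //; split.
      by apply: (le_trans uF); rewrite ler_wpM2l ?wS// ltW// eps0.
    apply: (slip_le _ uT); rewrite lerD2l ler_wpM2l ?(ltW (eps0 _ Uy))//.
    rewrite lef_pV2 ?posrE ?exprn_gt0// exprS ler_peMl ?exprn_ge0// ler1n//.
split.
  by apply: Csmooth_local => // x /key[].
move=> x Ux; have [_ [H1 H2]] := key x Ux; split.
  by apply: (le_trans H1); rewrite ler_piMr// ltW// eps0.
by rewrite expr0 invr1 mulr1 in H2.
Qed.

End smooth_gluing.

(** * Strictly differentiable Lipschitz extension *)

Section strict_extension.
Context {R : realType} {X Y : normedModType R}.

Lemma condition_W_local (A : set X) (f : X -> Y) (G : X -> 'L(X, Y)) a e :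
  condition_W A f G -> A a -> 0 < e -> exists2 d, 0 < d &
   (forall y z, A y -> A z -> `|y - a| < d -> `|z - a| < d ->
      `|f z - f y - G a (z - y)| <= e * `|z - y|) /\
   (forall y, A y -> `|y - a| < d -> `|G a - G y| <= e).
Proof.
move=> [cG sG] Aa e0; have [d d0 fd] := sG a Aa e e0.
have /subspace_continuousP/(_ a Aa)/cvgrPdist_le/(_ e e0) := cG.
rewrite near_withinE => /nbhs_ballP[r /= r0 rG].
exists (Num.min d r); first by rewrite lt_min d0.
split=> [y z Ay Az|y Ay]; rewrite !lt_min.
  by move=> /andP[/ball_distE yd _] /andP[/ball_distE zd _]; exact: fd.
by move=> /andP[_ /ball_distE yr]; exact: rG.
Qed.

Lemma relatively_closed_diff_open (Omega A : set X) : open Omega ->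
  relatively_closed Omega A -> open (Omega `\` A).
Proof.
move=> oO [F cF ->]; rewrite setDIr setDv set0U.
by rewrite setDE; apply: openI => //; exact: closed_openC.
Qed.

(* Pasting local extensions with Lipschitz partition functions does not spoil
   smallness near [A]: all the extensions agree on [A], so the derivatives of
   the partition functions only multiply differences vanishing on [A]. *)
Lemma local_strict_extension (C C' : R) (Omega A : set X) (f : X -> Y)
    (G : X -> 'L(X, Y)) e :
  open Omega -> relatively_closed Omega A -> property_LE X Y C ->
  property_LA_with X R (Some 1%N) C' -> condition_W A f G -> 0 < e ->
  exists F : X -> Y, forall a, A a -> F a = f a /\ slip F a (G a) e.
Proof.
move=> oO cA [C0 hLE] hLA hW e0.
(* Extending [f - G c] by (LE) costs [C * e1], and replacing [G c] by [G a] costs another [e1]. *)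
pose e1 := e / (C + 1).
have C10 : 0 < C + 1 by rewrite addr_gt0.
have e10 : 0 < e1 by rewrite divr_gt0.
have eE : C * e1 + e1 = e by rewrite /e1; field; rewrite gt_eqF.
have /choice[rF rFP] c : exists rF : R * (X -> Y), Omega c -> 0 < rF.1 /\
    forall a, A a -> `|a - c| < rF.1 -> rF.2 a = f a /\ slip rF.2 a (G a) e.
  have [Oc|nO] := pselect (Omega c); last by exists (0, fun=> 0).
  have [Ac|nA] := pselect (A c); last first.
    have [|r r0 rA] := open_ball_sub (relatively_closed_diff_open oO cA) (x := c).
      by split.
    by exists (r, fun=> 0) => _; split => // a Aa /rA[].
  have [d d0 [fd Gd]] := condition_W_local hW Ac e10.
  have [||E EL EA] := hLE (A `&` ball c d) e1 (fun x => f x - G c x).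
  - exact: ltW.
  - apply/lip_onP => x y [Ax /ball_distE xd] [Ay /ball_distE yd].
    rewrite (_ : _ - _ = f x - f y - G c (x - y)); first exact: fd.
    by rewrite clinB; lmod.
  exists (d, fun x => G c x + E x) => _ /=; split => // a Aa ad; split.
    have Ea : E a = f a - G c a by apply: EA; split; [|exact/ball_distE].
    by rewrite Ea; lmod.
  rewrite -eE; apply: (@slip_shift _ _ _ _ _ (G c)); first exact: Gd.
  apply: (@slip_ball _ _ _ _ a 1); first by rewrite subrr normr0.
  have /lip_onP EL' := EL => x y _ _.
  rewrite (_ : _ - _ = E x - E y); last by lmod.
  exact: EL'.
have [psi [cen [q [M sf]]]] := @step_functions_exist _ _ _ _ Omega
  (fun c => (rF c).1) hLA (fun c Oc => (rFP c Oc).1).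
pose h (n : nat) c := (rF c).2.
exists (glued psi cen q h) => a Aa.
have Oa : Omega a by case: cA Aa => F _ -> [].
apply: (glue_ind sf (h := h) (y := a)
  (P := fun n u => u a = f a /\ slip u a (G a) e)) => //.
- move=> n u v r r0 uv [ua us]; split; last exact: slip_near_eq uv us.
  by rewrite -uv// subrr normr0.
- by move=> n c Oc ac; have [_] := rFP c Oc; exact.
- move=> n c u Oc ac [ua us]; have [_ /(_ a Aa ac)[ha hs]] := rFP c Oc.
  split; first by rewrite /h ha ua -scalerDl addrC subrK scale1r.
  rewrite -[e]addr0 -[0](mulr0 (M n)).
  apply: (@slip_combine _ _ _ _ _ _ _ _ _ _ _ (q n)) => //.
  + exact: (sf_radius sf).
  + exact: (sf_const sf).
  + exact: (sf_01 sf).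
  + by move=> x z xr zr; exact: (sf_lip sf (proj2 (ball_distE _ _ _) xr)
      (proj2 (ball_distE _ _ _) zr)).
  + by rewrite /h ha ua subrr normr0.
Qed.

(** The local extension is controlled only near [A], so it is restricted to a neighbourhood [N] of
    [A] and extended again by (LE). Two points of [N] are either in one ball where the constant is
    [K = L + 2 e], or are joined through nearby points [a], [b] of [A] with [|x - a|] and [|y - b|]
    at most [|x - y|]. Then [|a - b| <= 3 |x - y|], and the constant is
    [K + 3 L + K = 5 L + 4 e]. *)
Lemma strict_extension (C C' : R) (Omega A : set X) (f : X -> Y)
    (G : X -> 'L(X, Y)) L e :
  open Omega -> relatively_closed Omega A -> property_LE X Y C ->
  property_LA_with X R (Some 1%N) C' -> 0 <= L -> lip_on A f L ->
  condition_W A f G -> (forall a, A a -> `|G a| <= L) -> 0 < e ->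
  exists F : X -> Y, lip_on setT F (C * (5 * L + 4 * e)) /\
    forall a, A a -> F a = f a /\ slip F a (G a) e.
Proof.
move=> oO cA hLE hLA L0 fL hW GL e0.
have [F FA] := local_strict_extension oO cA hLE hLA hW e0.
pose K := L + 2 * e.
have K0 : 0 <= K by rewrite addr_ge0// mulr_ge0// ltW.
have /choice[s sP] a : exists s, A a -> 0 < s /\ lip_on (ball a s) F K.
  have [Aa|nA] := pselect (A a); last by exists 0.
  have [_ /(_ e e0)[s s0 Fs]] := FA a Aa.
  exists s => _; split => // x y /ball_distE xs /ball_distE ys.
  rewrite -[F x - F y](subrK (G a (x - y))) (le_trans (ler_normD _ _))//.
  rewrite /K addrC mulrDl lerD//.
    by rewrite (le_trans (clin_le _ _))// ler_wpM2r// GL.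
  by rewrite mulr_natl mulr2n; exact: Fs.
pose N := [set x | exists2 a, A a & `|x - a| < s a / 2].
have FN : lip_on N F (5 * L + 4 * e).
  have H a b x y : A a -> A b -> `|x - a| < s a / 2 -> `|y - b| < s b / 2 ->
      s b <= s a -> `|F x - F y| <= (5 * L + 4 * e) * `|x - y|.
    move=> Aa Ab xa yb sba.
    have [sa0 Fa] := sP a Aa; have [sb0 Fb] := sP b Ab.
    have [xy|xy] := ltP `|x - y| (s a / 2).
      apply: (@le_trans _ _ (K * `|x - y|)).
        apply: Fa; apply/ball_distE; first by apply: (lt_trans xa); lra.
        by have := ler_distD x y a; rewrite (distrC y x) => H; lra.
      by rewrite ler_wpM2r// /K; lra.
    have Fxa : `|F x - F a| <= K * `|x - a|.
      by apply: Fa; apply/ball_distE; rewrite ?subrr ?normr0//; lra.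
    have Fyb : `|F b - F y| <= K * `|y - b|.
      by rewrite distrC; apply: Fb; apply/ball_distE; rewrite ?subrr ?normr0//; lra.
    have Fab : `|F a - F b| <= L * `|a - b|.
      by rewrite (FA a Aa).1 (FA b Ab).1; exact: fL.
    have ab : `|a - b| <= 3 * `|x - y|.
      rewrite (_ : a - b = - (x - a) + (x - y) + (y - b)); last by lmod.
      rewrite (le_trans (ler_normD _ _))//.
      have := ler_normD (- (x - a)) (x - y); rewrite normrN => H.
      lra.
    rewrite (_ : F x - F y = (F x - F a) + (F a - F b) + (F b - F y)); last by lmod.
    rewrite (le_trans (ler_normD _ _))//.
    have := ler_normD (F x - F a) (F a - F b) => H1.
    have K1 : K * `|x - a| <= K * `|x - y| by rewrite ler_wpM2l//; lra.
    have K2 : K * `|y - b| <= K * `|x - y| by rewrite ler_wpM2l//; lra.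
    have L1 : L * `|a - b| <= L * (3 * `|x - y|) by rewrite ler_wpM2l.
    have -> : (5 * L + 4 * e) * `|x - y| = K * `|x - y| + L * (3 * `|x - y|) + K * `|x - y|.
      by rewrite /K; ring.
    by rewrite lerD ?(le_trans Fyb)// (le_trans H1)// lerD// ?(le_trans Fxa)// (le_trans Fab).
  move=> x y [a Aa xa] [b Ab yb]; have [ba|/ltW ab] := leP (s b) (s a).
    exact: (H a b).
  by rewrite distrC (distrC x); exact: (H b a).
have [_ HLE] := hLE.
have [||E EL EN] := HLE N (5 * L + 4 * e) F.
- by rewrite addr_ge0// mulr_ge0// ltW.
- exact/lip_onP.
exists E; split; first exact/lip_onP.
move=> a Aa; have [sa0 _] := sP a Aa; have [Fa Fs] := FA a Aa.
have sa2 : 0 < s a / 2 by rewrite divr_gt0.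
have FE z : `|z - a| < s a / 2 -> F z = E z by move=> za; rewrite EN//; exists a.
split; first by rewrite -FE ?subrr ?normr0.
exact: slip_near_eq sa2 FE Fs.
Qed.

End strict_extension.

(** * C^1 approximation *)

Section c1_approximation.
Context {R : realType} {X Y : normedModType R}.

(* Either the segment from [x] to [y] stays in [U], or both distances to the
   complement of [U] are at most [`|x - y|]. *)
Lemma lip_on_of_close (U S : set X) (H F : X -> Y) (K d : R) : 0 <= d ->
  S `<=` U -> (forall x, U x -> pointwise_lip H x K) -> lip_on S F K ->
  (forall x, S x -> `|H x - F x| <= d * tdist (~` U) x) ->
  lip_on S H (K + 2 * d).
Proof.
move=> d0 SU HK FK HF.
have seg x y : `|y - x| < tdist (~` U) x -> `|H y - H x| <= (K + 2 * d) * `|y - x|.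
  move=> yx; apply: (@le_trans _ _ (K * `|y - x|)).
    apply: segment_lip => t /andP[t0 t1]; apply: HK.
    apply: (@tdist_compl_ball _ _ _ x); apply: le_lt_trans yx.
    by rewrite addrC addKr normrZ ger0_norm// ler_piMl.
  by rewrite ler_wpM2r// lerDl mulr_ge0.
move=> x y Sx Sy.
have [xy|xy] := ltP `|x - y| (tdist (~` U) x).
  by rewrite distrC (distrC x); apply: seg; rewrite distrC.
have [yx|yx] := ltP `|x - y| (tdist (~` U) y); first exact: seg.
rewrite (_ : H x - H y = (F x - F y) + ((H x - F x) - (H y - F y))); last by lmod.
rewrite (le_trans (ler_normD _ _))// mulrDl lerD ?FK//.
rewrite (le_trans (ler_normB _ _))// mulrAC mulr_natl mulr2n.
by rewrite mulrDl lerD// ?(le_trans (HF _ Sx))// ?(le_trans (HF _ Sy))//;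
  rewrite mulrC ler_wpM2r.
Qed.

(** Near a point of [N], where [F] is almost affine, the pieces are [tau c] plus an (LA) approximant
    of [F - tau c]; elsewhere they are plain (LA) approximants of [F], with [T = 0]. The latter live
    on balls missing a smaller neighbourhood [N2] of [A], so on [N2] only the former occur. The
    choice [tau] may jump, but [slip_uniq] keeps [tau c] close to [tau x]. *)
Lemma c1_approximation (C C' : R) (Omega A : set X) (f : X -> Y)
    (G : X -> 'L(X, Y)) L e :
  1 <= C -> open Omega -> relatively_closed Omega A -> property_LE X Y C ->
  property_LA_with X Y (Some 1%N) C -> property_LA_with X R (Some 1%N) C' ->
  0 <= L -> lip_on A f L ->
  condition_W A f G -> (forall a, A a -> `|G a| <= L) -> 0 < e ->
  exists h : X -> Y, [/\ Cfin 1 Omega h, lip_on Omega h (5 * C ^+ 2 * L + e),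
    forall a, A a -> `|f a - h a| <= e, lip_on A (fun x => f x - h x) e &
    forall a, A a -> `|G a - frechet h a| <= e].
Proof.
move=> C1 oO cA hLE hLA hLA' L0 fL hW GL e0.
have AO a : A a -> Omega a by case: cA => F _ -> [].
have C0 : 0 <= C by apply: le_trans C1.
(* The term [4 C^2] comes from the [4 d] in the constant of [F], multiplied by [C] in (LE) and again
   in (LA). On [N2] the slope error is [2 C d] from (LA), [4 d] from changing [tau] and [d] from
   gluing; comparison with [F] adds [2 d], and [lip_on_of_close] another [2 d]. *)
pose d := e / (4 * C ^+ 2 + 2 * C + 9).
have D0 : 0 < 4 * C ^+ 2 + 2 * C + 9.
  by rewrite ltr_wpDl// addr_ge0// mulr_ge0// exprn_ge0.
have d0 : 0 < d by rewrite divr_gt0.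
have dE : (4 * C ^+ 2 + 2 * C + 9) * d = e by rewrite /d mulrC divfK// gt_eqF.
have [F [FL FA]] := strict_extension oO cA hLE hLA' L0 fL hW GL d0.
pose KF := C * (5 * L + 4 * d).
have KF0 : 0 <= KF by rewrite mulr_ge0// addr_ge0// mulr_ge0// ltW.
have KFC : KF <= C * KF by rewrite ler_peMl.
pose good T x r := 0 < r /\ lip_on (ball x r) (fun z => F z - (T : 'L(X, Y)) z) (2 * d).
pose N := [set x | Omega x /\ exists T r, good T x r].
have good_sub T x r y : good T x r -> `|y - x| < r -> good T y (r - `|y - x|).
  move=> [r0 FT] yx; split; first by rewrite subr_gt0.
  apply: lip_on_sub FT => z /ball_distE zy; apply/ball_distE.
  by have := ler_distD y z x; lra.
have good_slip T x r : good T x r -> slip F x T (2 * d).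
  by move=> [r0 FT]; apply: (slip_ball _ FT); rewrite subrr normr0.
have F_slip0 x : slip F x 0 KF.
  apply: (@slip_ball _ _ _ _ x 1); first by rewrite subrr normr0.
  by move=> u v _ _; rewrite !subr0; exact: FL.
have oN : open N.
  rewrite openE => x [Ox [T [r gT]]]; have [r0 _] := gT.
  have [s s0 sO] := open_ball_sub oO Ox.
  apply/nbhs_ballP; exists (Num.min r s); first by rewrite /= lt_min r0.
  move=> y /ball_distE; rewrite lt_min => /andP[yr /sO Oy]; split => //.
  by exists T, (r - `|y - x|); exact: good_sub.
have AN a : A a -> N a.
  move=> Aa; split; first exact: AO.
  have [_ /(_ d d0)[r r0 Fr]] := FA a Aa; exists (G a), r; split => //.
  move=> x y /ball_distE xr /ball_distE yr.
  rewrite (_ : _ - _ = F x - F y - G a (x - y)); last by rewrite clinB; lmod.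
  by rewrite mulr_natl mulr2n; exact: Fr.
have /choice[tau tauP] x : exists T : 'L(X, Y), N x -> exists r, good T x r.
  by have [[_ [T H]]|nN] := pselect (N x); [exists T|exists 0].
(* A centre [c] outside [N] has a ball of radius [tdist A c / 2] that misses [N2]. *)
pose N2 := [set x | Omega x /\ tdist A x < tdist (~` N) x].
have N2N x : N2 x -> N x.
  move=> [_ H]; apply: contrapT => nN; move: H.
  by rewrite (@tdist_eq0 _ _ (~` N))// ltNge tdist_ge0.
have oN2 : open N2.
  rewrite openE => x [Ox xN]; have [s s0 sO] := open_ball_sub oO Ox.
  pose r := (tdist (~` N) x - tdist A x) / 2.
  have r0 : 0 < r by rewrite divr_gt0// subr_gt0.
  apply/nbhs_ballP; exists (Num.min r s); first by rewrite /= lt_min r0.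
  move=> y /ball_distE; rewrite lt_min => /andP[yr /sO Oy]; split => //.
  have := tdist_lip1 A y x; have := tdist_lip1 (~` N) x y; rewrite (distrC x).
  by move: yr; rewrite /r; lra.
have AN2 a : A a -> N2 a.
  move=> Aa; split; first exact: AO.
  by rewrite tdist_eq0//; apply: tdist_compl_gt0 => //; exact: AN.
have tA c : Omega c -> ~ A c -> 0 < tdist A c.
  move=> Oc nA; have [|r r0 rA] := open_ball_sub
    (relatively_closed_diff_open oO cA) (x := c); first by split.
  apply: (tdist_gt0 r0) => v Av; rewrite leNgt; apply/negP => cv.
  by have [|_] := rA v; rewrite 1?distrC.
(* The first term serves the Lipschitz bound on [Omega]. On [A] the maximum equals the distance to
   the complement of [N2], as needed to bound [F - H] on [A] from its slope on [N2]; the term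
   [tdist A] keeps [mu] positive off [N2]. *)
pose mu x := Num.min (tdist (~` Omega) x) (Num.max (tdist A x) (tdist (~` N2) x)).
have mu0 x : Omega x -> 0 < mu x.
  move=> Ox; rewrite lt_min tdist_compl_gt0//= lt_max.
  have [/AN2 Ax|nA] := pselect (A x); last by rewrite tA.
  by rewrite [X in _ || X]tdist_compl_gt0// orbT.
have mu1 x : mu x <= 1 by rewrite /mu ge_min tdist_le1.
have muO x : mu x <= tdist (~` Omega) x by rewrite /mu ge_min lexx.
have mu_lip x c : mu c <= mu x + `|x - c|.
  rewrite distrC; have H1 := tdist_lip1 (~` Omega) c x.
  have H2 := tdist_lip1 A c x; have H3 := tdist_lip1 (~` N2) c x.
  rewrite /mu -lerBlDr le_min !lerBlDr !ge_min H1/= ge_max.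
  by case: (leP (tdist A x) (tdist (~` N2) x)) => H4; apply/orP; right;
    apply/andP; split; lra.
pose T x := if `[< N2 x >] then tau x else 0.
pose bK := C * KF + (2 * C + 4) * d.
pose b x := if `[< N2 x >] then (2 * C + 4) * d else bK.
have TN x : N2 x -> T x = tau x by move=> H; rewrite /T ifT//; apply/asboolP.
have bN x : N2 x -> b x = (2 * C + 4) * d.
  by move=> H; rewrite /b ifT//; apply/asboolP.
have Tn x : ~ N2 x -> T x = 0.
  by move=> H; rewrite /T ifF//; apply/negbTE/asboolPn.
have bn x : ~ N2 x -> b x = bK.
  by move=> H; rewrite /b ifF//; apply/negbTE/asboolPn.
have Cd0 : 0 <= (2 * C + 4) * d by apply: mulr_ge0; [lra|exact: ltW].
have [||H [cH HP]] := @smooth_gluing _ _ _ _ _ Omega F T b (fun x => d * mu x) oO hLA'.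
- by move=> x _; rewrite /b; case: ifP => // _; rewrite addr_ge0// mulr_ge0.
- move=> c Oc; have muc2 : 0 < mu c / 2 by rewrite divr_gt0// mu0.
  have base x : `|x - c| < mu c / 2 -> Omega x /\ d * (mu c / 2) <= d * mu x.
    move=> xc; split.
      apply: (@tdist_compl_ball _ _ _ c); apply: (lt_le_trans xc).
      by have := muO c; have := mu0 c Oc; lra.
    by rewrite ler_wpM2l ?(ltW d0)//; have := mu_lip x c; lra.
  have [Nc|nNc] := pselect (N c).
    have [r gr] := tauP c Nc; have [r0 Fr] := gr.
    exists (Num.min r (mu c / 2)), (d * (mu c / 2)); split.
    + by rewrite lt_min r0.
    + by rewrite mulr_gt0.
    + by move=> x; rewrite lt_min => /andP[_ /base].
    move=> eta eta0.
    have rho0 : 0 < Num.min r (mu c / 2) by rewrite lt_min r0.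
    have d20 : 0 <= 2 * d by rewrite mulr_ge0// ltW.
    have Fr' : lip_on (ball c (Num.min r (mu c / 2))) (fun z => F z - tau c z) (2 * d).
      by apply: lip_on_sub Fr; apply: le_ball; rewrite ge_min lexx.
    have [g [gL cg gF]] := LA_on_ball hLA rho0 d20 Fr' eta0.
    exists (fun x => tau c x + g x); split.
      by apply: CsmoothD; [exact: ball_open|apply: Csmooth_clin; exact: ball_open|exact: cg].
    move=> x xr; have xb : ball c (Num.min r (mu c / 2)) x by exact/ball_distE.
    split.
      rewrite (_ : _ - _ = - (F x - tau c x - g x)); last by lmod.
      by rewrite normrN; exact: gF.
    have hs : slip (fun z => tau c z + g z) x (tau c) (C * (2 * d)).
      apply: (slip_ball xr) => u v ur vr.
      by rewrite ![tau c _ + _]addrC !addrK; exact: gL.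
    move: xr; rewrite lt_min => /andP[xr _].
    have Fs : slip F x (tau c) (2 * d) := good_slip _ _ _ (good_sub _ _ _ _ gr xr).
    have [N2x|nN2x] := pselect (N2 x).
      rewrite TN// bN//; have [s gs] := tauP x (N2N x N2x).
      have tt : `|tau c - tau x| <= 2 * d + 2 * d.
        by apply: (slip_uniq _ Fs (good_slip _ _ _ gs)); rewrite addr_ge0.
      by apply: slip_le (slip_shift tt hs); lra.
    rewrite Tn// bn//; have tt : `|tau c - 0| <= 2 * d + KF.
      by apply: (slip_uniq _ Fs (F_slip0 x)); rewrite addr_ge0.
    apply: slip_le (slip_shift tt hs); rewrite /bK; lra.
  have tc : 0 < tdist A c by apply: tA => // /AN.
  exists (Num.min (tdist A c / 2) (mu c / 2)), (d * (mu c / 2)).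
  have rho0 : 0 < Num.min (tdist A c / 2) (mu c / 2) by rewrite lt_min divr_gt0.
  split => //.
  + by rewrite mulr_gt0.
  + by move=> x; rewrite lt_min => /andP[_ /base].
  move=> eta eta0.
  have FL' : lip_on (ball c (Num.min (tdist A c / 2) (mu c / 2))) F KF.
    exact: lip_on_sub FL.
  have [g [gL cg gF]] := LA_on_ball hLA rho0 KF0 FL' eta0.
  exists g; split => // x xr; split.
    by rewrite distrC; apply: gF; exact/ball_distE.
  have nN2x : ~ N2 x.
    move=> [_ xN]; move: xr; rewrite lt_min => /andP[xr _].
    have := tdist_lip1 A c x; have := @tdist_le _ _ (~` N) x c nNc.
    by rewrite (distrC c x); lra.
  rewrite Tn// bn//; apply: slip_le (_ : slip g x 0 (C * KF)).
    by rewrite /bK lerDl.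
  by apply: (slip_ball xr) => u v ur vr; rewrite !subr0; exact: gL.
have dmu x : d * mu x <= d by rewrite ler_piMr// ltW.
have HN2 x : N2 x -> slip H x (tau x) ((2 * C + 5) * d).
  move=> N2x; have [_] := HP x N2x.1; rewrite TN// bN//; apply: slip_le.
  by have := dmu x; lra.
have Ftau x : N2 x -> slip F x (tau x) (2 * d).
  by move=> N2x; have [s gs] := tauP x (N2N x N2x); exact: good_slip gs.
pose K := C * KF + (2 * C + 7) * d.
have H0 x : Omega x -> slip H x 0 K.
  move=> Ox; have [N2x|nN2x] := pselect (N2 x).
    have tt : `|tau x - 0| <= 2 * d + KF.
      by apply: (slip_uniq _ (Ftau x N2x) (F_slip0 x)); rewrite addr_ge0// mulr_ge0// ltW.
    by apply: slip_le (slip_shift tt (HN2 x N2x)); rewrite /K; lra.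
  have [_] := HP x Ox; rewrite Tn// bn//; apply: slip_le.
  by rewrite /bK /K; have := dmu x; lra.
have de : (2 * C + 9) * d <= e.
  by rewrite -dE ler_wpM2r ?(ltW d0)//; have := sqr_ge0 C; lra.
have C2 : 0 <= C ^+ 2 by exact: sqr_ge0.
exists H; split.
- exact: cH.
- have -> : 5 * C ^+ 2 * L + e = K + 2 * d by rewrite /K /KF -dE; ring.
  apply: (@lip_on_of_close Omega Omega H F) => //; first exact: ltW.
  + by move=> x /H0; exact: slip_pointwise.
  + move=> x y _ _; apply: (le_trans (FL x y I I)); apply: ler_wpM2r => //.
    by apply: (le_trans KFC); rewrite lerDl; apply: mulr_ge0; [lra|exact: ltW].
  + move=> x Ox; have [HF _] := HP x Ox; apply: (le_trans HF).
    by rewrite ler_wpM2l// ltW.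
- move=> a Aa; have [HF _] := HP a (AO a Aa); rewrite -(FA a Aa).1 distrC.
  apply: (le_trans HF); apply: (le_trans (dmu a)); apply: le_trans de.
  by rewrite ler_peMl ?(ltW d0)//; lra.
- have FH : lip_on A (fun x => F x - H x) ((2 * C + 7) * d + 2 * d).
    apply: (@lip_on_of_close N2 A _ (fun=> 0)) => //; first exact: ltW.
    + move=> x N2x; apply: slip_pointwise.
      have := slipB (Ftau x N2x) (HN2 x N2x); rewrite subrr; apply: slip_le; lra.
    + by move=> x y _ _; rewrite subrr normr0 mulr_ge0//; apply: mulr_ge0; [lra|exact: ltW].
    + move=> a Aa; rewrite subr0 distrC; have [HF _] := HP a (AO a Aa).
      apply: (le_trans HF); rewrite ler_wpM2l ?(ltW d0)//.
      rewrite /mu (tdist_eq0 Aa) (max_r (tdist_ge0 _ _)).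
      by rewrite ge_min lexx orbT.
  move=> x y Ax Ay; rewrite -!(FA _ _).1//; apply: (le_trans (FH x y Ax Ay)).
  by rewrite ler_wpM2r//; lra.
- move=> a Aa; have N2a := AN2 a Aa.
  have G1 : `|G a - tau a| <= d + 2 * d.
    by apply: (slip_uniq _ (FA a Aa).2 (Ftau a N2a)); lra.
  have G2 : `|frechet H a - tau a| <= (2 * C + 5) * d.
    apply: (slip_derivative _ (HN2 a N2a)).
      by apply: mulr_ge0; [lra|exact: ltW].
    by apply: has_frechet_frechet; apply: cH.1; exact: AO.
  rewrite (_ : _ - _ = (G a - tau a) - (frechet H a - tau a)); last by lmod.
  rewrite (le_trans (ler_normB _ _))//; lra.
Qed.

End c1_approximation.

(** * C^1 extension *)

(** Completeness with an explicit rate, stated as a property of a [normedModType] so that it can be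
    a hypothesis of lemmas about ['L(X, Y)]. *)
Definition has_cauchy_limits (R : realType) (Y : normedModType R) :=
  forall (t : nat -> R) (u : nat -> Y), (forall e, 0 < e -> exists m, t m <= e) ->
  (forall m n, (m <= n)%N -> `|u n - u m| <= t m) ->
  exists l, forall m, `|l - u m| <= t m.

Lemma complete_has_cauchy_limits (R : realType) (Y : completeNormedModType R) :
  has_cauchy_limits Y.
Proof.
move=> t u t_small ut.
have cu : cvgn u.
  apply: cauchy_cvg; apply: cauchy_exP => e e0.
  have [m tm] := t_small (e / 2) (divr_gt0 e0 (ltr0n _ 2)).
  exists (u m); exists m => // n /= mn.
  rewrite -ball_normE /= distrC; apply: (le_lt_trans (ut _ _ mn)).
  by apply: (le_lt_trans tm); rewrite ltr_pdivrMr// ltr_pMr// ltr1n.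
exists (lim (u @ \oo)) => m; apply/ler_addgt0Pr => e e0.
have /cvgrPdist_le/(_ e e0)[n _ un] := cu.
have := un (maxn n m) (leq_maxl _ _) => /= H1.
have H2 := ut _ _ (leq_maxr n m).
rewrite -(subrK (u (maxn n m)) (lim _)) -addrA (le_trans (ler_normD _ _))//.
by rewrite [leRHS]addrC lerD.
Qed.

(** * Limits with a prescribed rate *)

Section limits.
Context {R : realType} {X Y : normedModType R}.
Hypothesis hY : has_cauchy_limits Y.
Variable t : nat -> R.
Hypothesis t_small : forall e, 0 < e -> exists m, t m <= e.

Lemma scaled_limit (u : nat -> Y) (c : R) : 0 <= c ->
  (forall m n, (m <= n)%N -> `|u n - u m| <= t m * c) ->
  exists l, forall m, `|l - u m| <= t m * c.
Proof.
move=> c0 ut; apply: (hY (t := fun m => t m * c)) => // e e0.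
have c10 : 0 < c + 1 by rewrite ltr_wpDl.
have [m tm] := t_small (divr_gt0 e0 c10); exists m.
apply: (@le_trans _ _ (e / (c + 1) * c)); first by rewrite ler_wpM2r.
by rewrite mulrAC ler_pdivrMr// ler_wpM2l ?(ltW e0)// lerDl.
Qed.

Lemma clin_limit (T : nat -> 'L(X, Y)) :
  (forall m n, (m <= n)%N -> `|T n - T m| <= t m) ->
  exists S : 'L(X, Y), forall m, `|S - T m| <= t m.
Proof.
move=> Tt.
have /choice[s sP] x : exists l, forall m, `|l - T m x| <= t m * `|x|.
  apply: scaled_limit => // m n mn; rewrite -clin_subE.
  by apply: (le_trans (clin_le _ _)); rewrite ler_wpM2r// Tt.
have t0 m : 0 <= t m by apply: le_trans (Tt m m (leqnn m)).
have lins : linear s.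
  move=> a x y; apply/eqP; rewrite -subr_eq0 -normr_le0; apply/ler_addgt0Pr => e e0.
  rewrite add0r; pose c := `|a *: x + y| + `|a| * `|x| + `|y| + 1.
  have c0 : 0 < c by rewrite ltr_wpDl// !addr_ge0// mulr_ge0.
  have [m tm] := t_small (divr_gt0 e0 c0).
  rewrite (_ : _ - _ = (s (a *: x + y) - T m (a *: x + y)) - a *: (s x - T m x)
     - (s y - T m y)); last by rewrite clinD clinZ; lmod.
  rewrite (le_trans (ler_normB _ _))//.
  rewrite (le_trans (lerD (ler_normB _ _) (lexx _)))// normrZ.
  apply: (@le_trans _ _ (t m * `|a *: x + y| + `|a| * (t m * `|x|) + t m * `|y|)).
    by rewrite !lerD// ?sP// ler_wpM2l.
  have -> : t m * `|a *: x + y| + `|a| * (t m * `|x|) + t m * `|y| = t m * (c - 1).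
    by rewrite /c; ring.
  apply: (@le_trans _ _ (t m * c)); first by rewrite ler_wpM2l// gerBl.
  by rewrite -ler_pdivlMr.
have sb x : `|s x| <= (t 0%N + `|T 0%N|) * `|x|.
  rewrite -(subrK (T 0%N x) (s x)) (le_trans (ler_normD _ _))// mulrDl.
  by rewrite lerD ?sP// clin_le.
have [S SE] := linear_bounded_clin lins sb.
exists S => m; apply: clin_norm_le => // x.
by rewrite clin_subE SE.
Qed.

End limits.

Section c1_limits.
Context {R : realType} {X Y : normedModType R}.

Lemma lip_on_slip (U : set X) (u : X -> Y) K x : open U -> U x ->
  lip_on U u K -> slip u x 0 K.
Proof.
move=> oU Ux uK; have [r r0 rU] := open_ball_sub oU Ux.
apply: (@slip_ball _ _ _ _ x r); first by rewrite subrr normr0.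
by move=> y z /ball_distE/rU Uy /ball_distE/rU Uz; rewrite !subr0; exact: uK.
Qed.

Lemma lip_on_frechet (U : set X) (u : X -> Y) K x S : open U -> U x -> 0 <= K ->
  lip_on U u K -> has_frechet u x S -> `|S| <= K.
Proof.
move=> oU Ux K0 uK uS.
by have := slip_derivative K0 (lip_on_slip oU Ux uK) uS; rewrite subr0.
Qed.

Lemma has_frechetB (u v : X -> Y) x S T : has_frechet u x S -> has_frechet v x T ->
  has_frechet (fun z => u z - v z) x (S - T).
Proof.
move=> uS vT; apply: (has_frechetD uS) => e /vT[d d0 vd].
exists d => // z /vd; rewrite clin_oppE -normrN.
by rewrite (_ : - (_ - _ - _) = - v z - - v x - - T (z - x))//; lmod.
Qed.

(** The Lipschitz bound on [g n - g m] controls at once the difference of the derivatives and that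
    of the increments, so differentiation passes to the limit. Values are compared through [a0],
    whence the factor [|x - a0| + 1]. *)
Lemma c1_limit (Omega : set X) (g : nat -> X -> Y) (t : nat -> R) a0 :
  has_cauchy_limits Y ->
  open Omega -> Omega a0 -> (forall e, 0 < e -> exists m, t m <= e) ->
  (forall m n, (m <= n)%N -> t n <= t m) ->
  (forall n, Cfin 1 Omega (g n)) ->
  (forall m n, (m <= n)%N -> lip_on Omega (fun x => g n x - g m x) (t m)) ->
  (forall m n, (m <= n)%N -> `|g n a0 - g m a0| <= t m) ->
  exists g' : X -> Y, [/\ Cfin 1 Omega g',
    forall m, lip_on Omega (fun x => g' x - g m x) (t m),
    forall x m, Omega x -> `|g' x - g m x| <= t m * (`|x - a0| + 1) &
    forall x m, Omega x -> `|frechet g' x - frechet (g m) x| <= t m].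
Proof.
move=> hY oO Oa0 t_small tS cg gt ga0.
have t0 m : 0 <= t m by apply: le_trans (ga0 m m (leqnn m)).
have /choice[g' g'P] x : exists l, Omega x ->
    forall m, `|l - g m x| <= t m * (`|x - a0| + 1).
  have [Ox|nO] := pselect (Omega x); last by exists 0.
  have [||l lP] := scaled_limit hY t_small (u := fun n => g n x) (c := `|x - a0| + 1).
  - by rewrite addr_ge0.
  - move=> m n mn; rewrite (_ : _ - _ = ((g n x - g m x) - (g n a0 - g m a0)) +
      (g n a0 - g m a0)); last by lmod.
    by rewrite (le_trans (ler_normD _ _))// mulrDr mulr1 lerD// ?ga0// gt.
  - by exists l.
have lipg' m : lip_on Omega (fun x => g' x - g m x) (t m).
  move=> x y Ox Oy; apply/ler_addgt0Pr => e e0.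
  pose c := `|x - a0| + 1 + (`|y - a0| + 1).
  have c0 : 0 < c by rewrite addr_gt0// ltr_wpDl.
  have [p tp] := t_small _ (divr_gt0 e0 c0).
  pose n := maxn m p; cbv beta.
  rewrite (_ : _ - _ - (_ - _) = ((g n x - g m x) - (g n y - g m y)) +
    ((g' x - g n x) - (g' y - g n y))); last by lmod.
  rewrite (le_trans (ler_normD _ _))// lerD//.
    by apply: gt => //; exact: leq_maxl.
  rewrite (le_trans (ler_normB _ _))//.
  apply: (@le_trans _ _ (t n * c)); first by rewrite /c mulrDr lerD// g'P.
  rewrite -ler_pdivlMr//; apply: le_trans tp; apply: tS; exact: leq_maxr.
have fg x n : Omega x -> has_frechet (g n) x (frechet (g n) x).
  by move=> Ox; apply: has_frechet_frechet; exact: (cg n).1.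
have /choice[D DP] x : exists S : 'L(X, Y), Omega x ->
    forall m, `|S - frechet (g m) x| <= t m.
  have [Ox|nO] := pselect (Omega x); last by exists 0.
  have [|S SP] := clin_limit hY t_small (T := fun n => frechet (g n) x).
    move=> m n mn; apply: (lip_on_frechet oO Ox _ (gt m n mn)) => //.
    by apply: has_frechetB; exact: fg.
  by exists S.
have fg' x : Omega x -> has_frechet g' x (D x).
  move=> Ox e e0; have e30 : 0 < e / 3 by rewrite divr_gt0.
  have [m tm] := t_small _ e30; have [d d0 gd] := fg x m Ox _ e30.
  have [r r0 rO] := open_ball_sub oO Ox.
  exists (Num.min d r); first by rewrite lt_min d0.
  move=> z; rewrite lt_min => /andP[/gd{}gd /rO Oz].
  rewrite (_ : _ - _ = ((g' z - g m z) - (g' x - g m x)) +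
    (g m z - g m x - frechet (g m) x (z - x)) - (D x - frechet (g m) x) (z - x));
    last by rewrite clin_subE !clinB; lmod.
  rewrite (le_trans (ler_normB _ _))//.
  rewrite (le_trans (lerD (ler_normD _ _) (lexx _)))//.
  have h1 := lipg' m z x Oz Ox.
  have h2 := clin_le (D x - frechet (g m) x) (z - x).
  have h3 : t m * `|z - x| <= e / 3 * `|z - x| by rewrite ler_wpM2r.
  have h4 : `|D x - frechet (g m) x| * `|z - x| <= t m * `|z - x|.
    by rewrite ler_wpM2r// DP.
  by lra.
have Dg' x : Omega x -> frechet g' x = D x by move=> /fg'/has_frechetP[].
exists g'; split => //.
- apply: (Cfin_succ oO fg'); apply/Cfin0P => // x Ox e e0.
  have e30 : 0 < e / 3 by rewrite divr_gt0.
  have [m tm] := t_small _ e30.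
  have [_ /Cfin0P-/(_ oO x Ox _ e30)[d d0 gd]] := cg m.
  have [r r0 rO] := open_ball_sub oO Ox.
  exists (Num.min d r); first by rewrite lt_min d0.
  move=> z; rewrite lt_min => /andP[/gd{}gd /rO Oz].
  rewrite (_ : _ - _ = (D z - frechet (g m) z) - (D x - frechet (g m) x) +
    (frechet (g m) z - frechet (g m) x)); last by lmod.
  rewrite (le_trans (ler_normD _ _))//.
  rewrite (le_trans (lerD (ler_normB _ _) (lexx _)))//.
  apply: (@le_trans _ _ (e / 3 + e / 3 + e / 3)); last lra.
  by apply: lerD => //; apply: lerD; exact: le_trans (DP _ _ m) tm.
- by move=> x m Ox; exact: g'P.
- by move=> x m Ox; rewrite Dg'//; exact: DP.
Qed.

End c1_limits.

Section c1_extension.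
Context {R : realType} {X Y : normedModType R}.

Lemma condition_W_sub (Omega A : set X) (f h : X -> Y) (G : X -> 'L(X, Y)) :
  open Omega -> A `<=` Omega -> Cfin 1 Omega h -> condition_W A f G ->
  condition_W A (fun x => f x - h x) (fun x => G x - frechet h x).
Proof.
move=> oO AO ch hW; split.
  apply/subspace_continuousP => a Aa; apply/cvgrPdist_le => e e0.
  have e20 : 0 < e / 2 by rewrite divr_gt0.
  have [d d0 [_ Gd]] := condition_W_local hW Aa e20.
  have [_ /Cfin0P-/(_ oO a (AO a Aa) _ e20)[r r0 hr]] := ch.
  rewrite near_withinE; apply/nbhs_ballP; exists (Num.min d r) => /=.
    by rewrite lt_min d0.
  move=> z /ball_distE; rewrite lt_min => /andP[zd /hr zr] Az; cbv beta.
  rewrite (_ : _ - _ - (_ - _) = (G a - G z) + (frechet h z - frechet h a)); last by lmod.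
  by rewrite (le_trans (ler_normD _ _))// (splitr e) lerD// Gd.
move=> a Aa e e0; have e20 : 0 < e / 2 by rewrite divr_gt0.
have [d d0 [fd _]] := condition_W_local hW Aa e20.
have [r r0 hr] := Cfin1_slip oO ch (AO a Aa) e20.
exists (Num.min d r); first by rewrite lt_min d0.
move=> y z [/ball_distE + Ay] [/ball_distE + Az]; rewrite !lt_min.
move=> /andP[yd yr] /andP[zd zr]; cbv beta.
rewrite clin_subE (_ : _ - _ - (_ - _) - _ = (f z - f y - G a (z - y)) -
  (h z - h y - frechet h a (z - y))); last by rewrite !clinB; lmod.
rewrite (le_trans (ler_normB _ _))// [e in leRHS]splitr mulrDl lerD ?fd//.
by have := hr z y zr yr; rewrite add0r.
Qed.

(** Stage [n] approximates a remainder with constant [l n = L / 2^n] up to [l n.+1], adding a map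
    with constant [5 C^2 l n + l n.+1]. The tail of these constants from stage [n] is [t n], and
    [t 0] is the asserted bound. *)
Lemma c1_extension (C C' : R) (Omega A : set X) (f : X -> Y)
    (G : X -> 'L(X, Y)) L :
  has_cauchy_limits Y -> 1 <= C -> open Omega -> relatively_closed Omega A -> A !=set0 ->
  property_LE X Y C ->
  property_LA_with X Y (Some 1%N) C -> property_LA_with X R (Some 1%N) C' ->
  0 < L -> lip_on A f L ->
  condition_W A f G -> (forall a, A a -> `|G a| <= L) ->
  exists g : X -> Y, [/\ Cfin 1 Omega g, lip_on Omega g ((10 * C ^+ 2 + 1) * L),
    forall a, A a -> g a = f a & forall a, A a -> frechet g a = G a].
Proof.
move=> hY C1 oO cA [a0 Aa0] hLE hLA hLA' L0 fL hW GL.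
have AO a : A a -> Omega a by case: cA => F _ -> [].
pose l n : R := L * 2 ^- n.
have l0 n : 0 < l n by rewrite mulr_gt0// invr_gt0 exprn_gt0.
have lS n : l n = l n.+1 + l n.+1 by rewrite /l exprS; field; rewrite expf_neq0.
pose good n (g : X -> Y) := [/\ Cfin 1 Omega g, lip_on A (fun x => f x - g x) (l n),
   forall a, A a -> `|G a - frechet g a| <= l n & `|f a0 - g a0| <= l n].
have /choice[next nextP] (ng : nat * (X -> Y)) : exists g' : X -> Y,
    good ng.1 ng.2 -> good ng.1.+1 g' /\
    lip_on Omega (fun x => g' x - ng.2 x) (5 * C ^+ 2 * l ng.1 + l ng.1.+1).
  case: ng => n g /=; have [gg|ng] := pselect (good n g); last by exists g.
  have [cg fgL GgL fga0] := gg.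
  have hW' := condition_W_sub oO AO cg hW.
  have [h [ch hL fh fhL Gh]] := c1_approximation C1 oO cA hLE hLA hLA'
    (ltW (l0 n)) fgL hW' GgL (l0 n.+1).
  exists (fun x => g x + h x) => _; split; last first.
    move=> x y Ox Oy; cbv beta.
    rewrite (_ : _ - _ - (_ - _) = h x - h y); last by lmod.
    exact: hL.
  have sub x : f x - (g x + h x) = f x - g x - h x by lmod.
  split.
  - exact: CfinD.
  - by move=> x y Ax Ay; rewrite !sub; exact: fhL.
  - move=> a Aa; have Oa := AO a Aa.
    have := has_frechetD (has_frechet_frechet (cg.1 a Oa)) (has_frechet_frechet (ch.1 a Oa)).
    move=> /has_frechetP[_ ->]; rewrite opprD addrA; exact: Gh.
  - by rewrite sub; exact: fh.
(* Starting from the constant [f a0] makes the first remainder vanish at [a0] while [f] and [G] keep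
   their bound [L]. *)
pose fix g n : X -> Y := if n is m.+1 then next (m, g m) else fun=> f a0.
have gg n : good n (g n).
  elim: n => [|n IH]; last by have [] := nextP (n, g n) IH.
  have l_0 : l 0%N = L by rewrite /l expr0 invr1 mulr1.
  split.
  - by apply: Cfin_cst.
  - move=> x y Ax Ay; rewrite l_0 /=.
    by rewrite (_ : _ - _ - (_ - _) = f x - f y); [exact: fL|lmod].
  - move=> a Aa; have /has_frechetP[_ /= ->] := has_frechet_cst (f a0) a.
    by rewrite subr0 l_0 GL.
  - by rewrite /= subrr normr0 ltW.
pose t n : R := (10 * C ^+ 2 + 1) * l n.
have C2 : 0 <= C ^+ 2 by exact: sqr_ge0.
have tE n : t n = (5 * C ^+ 2 * l n + l n.+1) + t n.+1 by rewrite /t lS; ring.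
have D0 : 0 < 10 * C ^+ 2 + 1 by rewrite ltr_wpDl// mulr_ge0.
have t0 n : 0 < t n by rewrite mulr_gt0.
have lt n : l n + l n <= t n.
  have : 1 <= C ^+ 2 by rewrite exprn_ege1.
  by rewrite /t; have := l0 n; nra.
have lmono m n : (m <= n)%N -> l n <= l m.
  move=> mn; rewrite -(subnKC mn); elim: (n - m)%N => [|j IH]; first by rewrite addn0.
  by apply: le_trans IH; rewrite addnS (lS (m + j)%N) lerDl ltW.
have tmono m n : (m <= n)%N -> t n <= t m.
  by move=> /lmono H; rewrite ler_wpM2l// ltW.
have t_small e : 0 < e -> exists m, t m <= e.
  move=> e0; pose c := (10 * C ^+ 2 + 1) * L.
  have c0 : 0 < c by rewrite mulr_gt0.
  exists (Num.bound (c / e)); set m := Num.bound _.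
  have H := archi_boundP (ltW (divr_gt0 c0 e0)); rewrite -/m in H.
  have m2 : m%:R <= (2 : R) ^+ m by rewrite -natrX ler_nat ltnW// ltn_expl.
  rewrite /t /l mulrA -/c ler_pdivrMr ?exprn_gt0// mulrC -ler_pdivrMr//.
  exact: le_trans (ltW H) m2.
have gt m n : (m <= n)%N -> lip_on Omega (fun x => g n x - g m x) (t m - t n).
  move=> mn; rewrite -(subnKC mn); elim: (n - m)%N => [|j IH].
    by rewrite addn0 => x y Ox Oy; rewrite !subrr normr0 mul0r.
  rewrite addnS => x y Ox Oy; have [_ H] := nextP (_, _) (gg (m + j)%N); cbv beta.
  rewrite (_ : _ - _ - (_ - _) = (g (m + j)%N x - g m x - (g (m + j)%N y - g m y)) +
    (g (m + j).+1 x - g (m + j)%N x - (g (m + j).+1 y - g (m + j)%N y))); last by lmod.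
  rewrite (le_trans (ler_normD _ _))//.
  rewrite (_ : t m - t (m + j).+1 = (t m - t (m + j)%N) + (t (m + j)%N - t (m + j).+1));
    last by ring.
  rewrite mulrDl lerD//; first exact: IH.
  by apply: (le_trans (H x y Ox Oy)); rewrite /= (tE (m + j)%N) addrK.
have [|||g' [cg' g'L g'x g'D]] := @c1_limit _ _ _ Omega g t a0 hY oO (AO a0 Aa0) t_small tmono.
- by move=> n; have [] := gg n.
- move=> m n mn x y Ox Oy; apply: (le_trans (gt m n mn x y Ox Oy)).
  by rewrite ler_wpM2r// gerBl ltW.
- move=> m n mn; have [_ _ _ H1] := gg n; have [_ _ _ H2] := gg m.
  rewrite (_ : _ - _ = (f a0 - g m a0) - (f a0 - g n a0)); last by lmod.
  rewrite (le_trans (ler_normB _ _))//; apply: le_trans (lt m).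
  by rewrite lerD// (le_trans H1)// lmono.
exists g'; split => //.
- move=> x y Ox Oy; have := g'L 0%N x y Ox Oy.
  rewrite /t /l expr0 invr1 mulr1 /=.
  by rewrite (_ : _ - _ - _ = g' x - g' y)//; lmod.
- move=> a Aa; apply/eqP; rewrite -subr_eq0 -normr_le0; apply/ler_addgt0Pr => e e0.
  rewrite add0r; pose c := 2 * (`|a - a0| + 1).
  have c0 : 0 < c by rewrite mulr_gt0// ltr_wpDl.
  have [m tm] := t_small _ (divr_gt0 e0 c0).
  (* On [A] the remainder [f - g m] is [l m]-Lipschitz and at most [l m] at [a0], hence at most
     [l m * (|a - a0| + 1)] at [a]. *)
  have [_ H1 _ H2] := gg m.
  rewrite (_ : _ - _ = (g' a - g m a) - ((f a - g m a - (f a0 - g m a0)) + (f a0 - g m a0)));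
    last by lmod.
  rewrite (le_trans (ler_normB _ _))//.
  have h1 := g'x a m (AO a Aa).
  have h2 := ler_normD (f a - g m a - (f a0 - g m a0)) (f a0 - g m a0).
  have h3 := H1 a a0 Aa Aa0.
  have h4 : l m * (`|a - a0| + 1) <= t m * (`|a - a0| + 1).
    by rewrite ler_wpM2r ?addr_ge0//; have := lt m; have := l0 m; lra.
  have h5 : t m * c <= e by rewrite -ler_pdivlMr.
  have h6 : t m * c = t m * (`|a - a0| + 1) + t m * (`|a - a0| + 1) by rewrite /c; ring.
  have h7 : l m * (`|a - a0| + 1) = l m * `|a - a0| + l m by ring.
  lra.
- move=> a Aa; apply/eqP; rewrite -subr_eq0 -normr_le0; apply/ler_addgt0Pr => e e0.
  rewrite add0r; have [m tm] := t_small (e / 2) (divr_gt0 e0 (ltr0n _ 2)).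
  have [_ _ H _] := gg m.
  rewrite (_ : _ - _ = (frechet g' a - frechet (g m) a) - (G a - frechet (g m) a));
    last by lmod.
  rewrite (le_trans (ler_normB _ _))//.
  have h1 := g'D a m (AO a Aa); have h2 := H a Aa; have h3 := lt m; have h4 := l0 m.
  lra.
Qed.

End c1_extension.

(** * Smoothing off A *)

Section smoothing.
Context {R : realType} {X Y : normedModType R}.

(** Near [c] the map [g] minus its derivative at [c] is [e1]-Lipschitz, so (LA) gives slope error
    [C * e1], and passing to the derivative at [x] adds [e1]. The local pieces account for one
    [eps x] and the gluing for the other. *)
Lemma fine_approximation k (C C' : R) (U : set X) (g : X -> Y) (eps : X -> R) :
  open U -> property_LA_with X Y k C -> property_LA_with X R k C' ->
  Cfin 1 U g ->
  (forall c, U c -> exists r e, [/\ 0 < r, 0 < e &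
     forall x, `|x - c| < r -> e <= eps x]) ->
  exists h : X -> Y, Csmooth k U h /\ forall x, U x ->
    `|h x - g x| <= eps x /\ slip h x (frechet g x) (eps x + eps x).
Proof.
move=> oU hLA hLA' cg epsP.
have C0 := hLA.1.
have eps0 x : U x -> 0 <= eps x.
  move=> /epsP[r [e [r0 e0 re]]]; apply: le_trans (ltW e0) (re x _).
  by rewrite subrr normr0.
apply: (smooth_gluing (b := eps) oU hLA') => // c Uc.
have [r [e [r0 e0 re]]] := epsP c Uc; have [s s0 sU] := open_ball_sub oU Uc.
pose e1 := e / (C + 1).
have C10 : 0 < C + 1 by rewrite ltr_wpDl.
have e10 : 0 < e1 by rewrite divr_gt0.
have eE : C * e1 + (e1 + 0) = e by rewrite /e1; field; rewrite gt_eqF.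
have [d d0 gd] := Cfin1_slip oU cg Uc e10.
pose rho := Num.min d (Num.min r s).
have rho0 : 0 < rho by rewrite /rho !lt_min d0 r0.
have grho : lip_on (ball c rho) (fun x => g x - frechet g c x) e1.
  move=> x y /ball_distE + /ball_distE; rewrite !lt_min => /andP[xd _] /andP[yd _].
  have := gd x y xd yd; rewrite add0r clinB.
  by rewrite (_ : _ - _ - (_ - _) = (g x - frechet g c x) - (g y - frechet g c y));
    last by lmod.
exists rho, e; split => //.
  by move=> x; rewrite !lt_min => /andP[_ /andP[/re xe /sU Ux]].
move=> eta eta0.
have [h [hL ch hg]] := LA_on_ball hLA rho0 (ltW e10) grho eta0.
exists (fun x => frechet g c x + h x); split.
  by apply: CsmoothD; [exact: ball_open|apply: Csmooth_clin; exact: ball_open|exact: ch].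
move=> x xr; have xb : ball c rho x by exact/ball_distE.
split.
  rewrite (_ : _ - _ = - (g x - frechet g c x - h x)); last by lmod.
  by rewrite normrN; exact: hg.
have hs : slip (fun z => frechet g c z + h z) x (frechet g c) (C * e1).
  apply: (slip_ball xr) => u v ur vr.
  by rewrite ![frechet g c _ + _]addrC !addrK; exact: hL.
have xr' := xr; move: xr'; rewrite !lt_min => /andP[_ /andP[/re xe /sU Ux]].
have gs : slip g x (frechet g c) e1 by exact: slip_ball xr grho.
have gg : `|frechet g c - frechet g x| <= e1 + 0.
  by apply: (slip_uniq _ gs (Cfin1_slip oU cg Ux)); rewrite addr0 ltW.
by apply: slip_le (slip_shift gg hs); rewrite eE.
Qed.

Lemma smooth_off (k : option nat) (C C' : R) (Omega A : set X) (g : X -> Y) (l eta : R) :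
  k <> Some 0%N -> open Omega -> relatively_closed Omega A ->
  property_LA_with X Y k C -> property_LA_with X R k C' ->
  0 <= l -> 0 < eta -> Cfin 1 Omega g -> lip_on Omega g l ->
  exists h : X -> Y, [/\ forall a, A a -> h a = g a, lip_on Omega h (l + 4 * eta),
    Cfin 1 Omega h, forall a, A a -> frechet h a = frechet g a &
    Csmooth k (Omega `\` A) h].
Proof.
move=> k0 oO cA hLA hLA' l0 eta0 cg gL.
have AO a : A a -> Omega a by case: cA => F _ -> [].
pose U := Omega `\` A.
have oU : open U := relatively_closed_diff_open oO cA.
have tA c : U c -> 0 < tdist A c.
  move=> Uc; have [r r0 rU] := open_ball_sub oU Uc.
  apply: (tdist_gt0 r0) => v Av; rewrite leNgt; apply/negP => cv.
  by have [|_] := rU v; rewrite 1?distrC.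
(* The square makes [h' - g] of order [o(|z - a|)] at points [a] of [A], so the derivative there is
   kept. The first factor serves [lip_on_of_close] on [Omega]. *)
pose m x := tdist (~` Omega) x * tdist A x ^+ 2.
have mO x : m x <= tdist (~` Omega) x.
  by rewrite /m ler_piMr ?tdist_ge0// exprn_ile1 ?tdist_ge0 ?tdist_le1.
have mA x : m x <= tdist A x ^+ 2.
  by rewrite /m ler_piMl ?exprn_ge0 ?tdist_ge0 ?tdist_le1.
have m1 x : m x <= 1 by apply: le_trans (mO x) (tdist_le1 _ _).
have m0 x : 0 <= m x by rewrite mulr_ge0 ?exprn_ge0 ?tdist_ge0.
pose eps x := eta * m x.
have [|h [ch hP]] := fine_approximation (eps := eps) oU hLA hLA'
    (Cfin_sub oO oU (@subDsetl _ Omega A) cg).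
  move=> c Uc; pose t1 := tdist (~` Omega) c; pose t2 := tdist A c.
  have t10 : 0 < t1 by apply: tdist_compl_gt0 => //; exact: Uc.1.
  have t20 : 0 < t2 := tA c Uc.
  exists (Num.min (t1 / 2) (t2 / 2)), (eta * (t1 / 2 * (t2 / 2) ^+ 2)); split.
  - by rewrite lt_min !divr_gt0.
  - by rewrite !mulr_gt0// ?exprn_gt0// divr_gt0.
  move=> x; rewrite lt_min => /andP[x1 x2]; rewrite /eps ler_pM2l//.
  have h1 : t1 / 2 <= tdist (~` Omega) x.
    by have := tdist_lip1 (~` Omega) c x; rewrite (distrC c) -/t1; lra.
  have h2 : t2 / 2 <= tdist A x.
    by have := tdist_lip1 A c x; rewrite (distrC c) -/t2; lra.
  have t2_ge0 : 0 <= t2 / 2 by rewrite divr_ge0// ltW.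
  apply: ler_pM => //; [by rewrite divr_ge0// ltW|exact: exprn_ge0|].
  by rewrite lerXn2r// nnegrE tdist_ge0.
have eps_eta x : eps x <= eta by rewrite /eps ler_piMr// ltW.
have eps0 x : 0 <= eps x by rewrite /eps mulr_ge0// ltW.
pose h' x := if `[< A x >] then g x else h x.
have hA a : A a -> h' a = g a by move=> Aa; rewrite /h' ifT//; apply/asboolP.
have hn x : ~ A x -> h' x = h x.
  by move=> nA; rewrite /h' ifF//; apply/negbTE/asboolPn.
have hg x : Omega x -> `|h' x - g x| <= eps x.
  move=> Ox; have [Ax|nA] := pselect (A x); first by rewrite hA// subrr normr0.
  by rewrite hn//; have [] := hP x (conj Ox nA).
have ch' : Csmooth k U h' by apply: Csmooth_ext ch => // x [_ nA]; rewrite hn.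
have c1h' := Csmooth_C1 k0 oU ch'.
have fgO x : Omega x -> has_frechet g x (frechet g x).
  by move=> Ox; apply: has_frechet_frechet; exact: cg.1.
have fA a : A a -> has_frechet h' a (frechet g a).
  move=> Aa e e0; have e20 : 0 < e / 2 by rewrite divr_gt0.
  have [d d0 gd] := fgO a (AO a Aa) _ e20.
  have [r r0 rO] := open_ball_sub oO (AO a Aa).
  exists (Num.min (Num.min d r) (e / 2 / eta)); first by rewrite !lt_min d0 r0 divr_gt0.
  move=> z; rewrite !lt_min => /andP[/andP[/gd{}gd /rO Oz] ze].
  rewrite (hA a Aa) (_ : _ - _ = (h' z - g z) + (g z - g a - frechet g a (z - a)));
    last by rewrite !clinB; lmod.
  rewrite (le_trans (ler_normD _ _))// [e in leRHS]splitr mulrDl lerD//.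
  apply: (le_trans (hg z Oz)); rewrite /eps.
  have h1 : m z <= `|z - a| ^+ 2.
    by apply: (le_trans (mA z)); rewrite lerXn2r ?nnegrE ?tdist_ge0 ?tdist_le.
  have h2 : eta * m z <= eta * `|z - a| ^+ 2 by rewrite ler_pM2l.
  apply: (le_trans h2); rewrite expr2 mulrA ler_wpM2r//.
  by move: ze; rewrite ltr_pdivlMr// mulrC => /ltW.
have DA a : A a -> frechet h' a = frechet g a by move=> /fA/has_frechetP[].
have dh' x : Omega x -> has_frechet h' x (frechet h' x).
  move=> Ox; have [Ax|nA] := pselect (A x); first by rewrite DA//; exact: fA.
  by apply: has_frechet_frechet; apply: c1h'.1.
have Dh' x : Omega x -> `|frechet h' x - frechet g x| <= eps x + eps x.
  move=> Ox; have [Ax|nA] := pselect (A x).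
    by rewrite DA// subrr normr0 addr_ge0.
  have Ux : U x by split.
  have [_ hs] := hP x Ux; have [r r0 rU] := open_ball_sub oU Ux.
  apply: (slip_derivative (u := h')); [by rewrite addr_ge0| |exact: dh'].
  by apply: slip_near_eq r0 _ hs => z /rU[_ nAz]; rewrite hn.
exists h'; split; [exact: hA| | |exact: DA|exact: ch'].
(* One [2 * eta] bounds the change of the derivative; the other is the price of
   [lip_on_of_close]. *)
- have -> : l + 4 * eta = l + 2 * eta + 2 * eta by ring.
  apply: (@lip_on_of_close _ _ _ Omega Omega h' g) => //; first exact: ltW.
  + move=> x Ox; apply: has_frechet_pointwise (dh' x Ox) _.
    rewrite -[frechet h' x](subrK (frechet g x)).
    apply: (le_trans (ler_normD _ _)); rewrite addrC; apply: lerD.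
      exact: (lip_on_frechet oO Ox l0 gL (fgO x Ox)).
    by apply: (le_trans (Dh' x Ox)); rewrite mulr_natl mulr2n lerD.
  + move=> x y Ox Oy; apply: (le_trans (gL x y Ox Oy)).
    by rewrite ler_wpM2r// lerDl mulr_ge0// ltW.
  + move=> x Ox; apply: (le_trans (hg x Ox)).
    by rewrite /eps ler_pM2l.
- apply: (Cfin_succ oO dh'); apply/Cfin0P => // x Ox e e0.
  have [Ax|nA] := pselect (A x); last first.
    by have [_ /Cfin0P-/(_ oU x (conj Ox nA) e e0)] := c1h'.
  have e20 : 0 < e / 2 by rewrite divr_gt0.
  have [_ /Cfin0P-/(_ oO x Ox _ e20)[d d0 gd]] := cg.
  have [r r0 rO] := open_ball_sub oO Ox.
  exists (Num.min (Num.min d r) (Num.min 1 (e / 4 / eta))).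
    by rewrite !lt_min d0 r0 ltr01 !divr_gt0.
  move=> z; rewrite !lt_min => /andP[/andP[/gd{}gd /rO Oz] /andP[z1 ze]].
  rewrite (DA x Ax) -[frechet h' z - _](subrKA (frechet g z)).
  apply: (le_trans (ler_normD _ _)); rewrite (splitr e); apply: lerD; last exact: gd.
  apply: (le_trans (Dh' z Oz)).
  have h1 : m z <= `|z - x|.
    apply: (le_trans (mA z)); apply: (@le_trans _ _ (tdist A z)).
      by rewrite expr2 ler_piMl ?tdist_ge0 ?tdist_le1.
    exact: tdist_le.
  have h2 : eps z <= e / 4.
    apply: (@le_trans _ _ (eta * `|z - x|)); first by rewrite /eps ler_pM2l.
    by move: ze; rewrite ltr_pdivlMr// mulrC => /ltW.
  lra.
Qed.

End smoothing.

(** * Degenerate cases and the final constant *)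

Theorem theorem40 (R : realType) (X : normedModType R)
    (Y : completeNormedModType R) (k : option nat) (C : R)
    (hC : 1 <= C)
    (hLE : property_LE X Y C)
    (hLA1 : property_LA_with X Y (Some 1%N) C)
    (hLAk : property_LA X Y k)
    (Omega A : set X)
    (hOmega : open Omega) (hconn : connected Omega)
    (hA : relatively_closed Omega A)
    (f : X -> Y) (G : X -> 'L(X, Y)) (L : R)
    (hL : 0 <= L)
    (hf : L.-lipschitz_A f)
    (hW : condition_W A f G)
    (hG : forall x, A x -> `|G x| <= L) :
  exists g : X -> Y,
    [/\ forall x, A x -> g x = f x,
        (17 * C ^+ 3 * L).-lipschitz_Omega g,
        Csmooth (Some 1%N) Omega g,
        forall x, A x -> frechet g x = G x &
        Csmooth k (Omega `\` A) g].
Proof.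
have oU := relatively_closed_diff_open hOmega hA.
have c30 : 0 <= 17 * C ^+ 3 * L.
  have C0 : 0 <= C by apply: le_trans hC.
  by apply: mulr_ge0 => //; apply: mulr_ge0 => //; exact: exprn_ge0.
have fL : lip_on A f L := (lip_onP A f L).1 hf.
(* Constants settle the cases of empty [A], [L = 0] and [Y = 0]. The main route takes a base point
   in [A], a positive [L] to halve, and a nonzero vector of [Y] for the scalar bumps. *)
have trivial_case (c : Y) : (forall x, A x -> f x = c) -> (forall x, A x -> G x = 0) ->
    exists g : X -> Y, [/\ forall x, A x -> g x = f x,
        (17 * C ^+ 3 * L).-lipschitz_Omega g, Csmooth (Some 1%N) Omega g,
        forall x, A x -> frechet g x = G x & Csmooth k (Omega `\` A) g].
  move=> fc G0; exists (fun=> c); split.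
  - by move=> x Ax; rewrite fc.
  - by apply/lip_onP => x y _ _; rewrite subrr normr0 mulr_ge0.
  - exact: Csmooth_cst.
  - by move=> x Ax; rewrite G0//; have /has_frechetP[] := has_frechet_cst c x.
  - exact: Csmooth_cst.
have [[a0 Aa0]|A0] := pselect (A !=set0); last first.
  by apply: (trivial_case 0) => x Ax; case: A0; exists x.
have [L0|Ln0] := eqVneq L 0.
  apply: (trivial_case (f a0)) => x Ax.
    apply/eqP; rewrite -subr_eq0 -normr_le0 -(mul0r `|x - a0|) -L0.
    exact: fL.
  by apply/eqP; rewrite -normr_le0 -L0 hG.
have {Ln0}L0 : 0 < L by rewrite lt_neqAle eq_sym Ln0.
have [[y0 y00]|Y0] := pselect (exists y : Y, y != 0); last first.
  have all0 (y : Y) : y = 0.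
    by apply/eqP; apply: contrapT => /negP y0; apply: Y0; exists y.
  by apply: (trivial_case 0) => x _; [exact: all0|apply: clin_eq => z; rewrite [LHS]all0 [RHS]all0].
have [C1 hLA1'] : property_LA X R (Some 1%N).
  by apply: (@LA_scalar _ _ Y _ _ y00); exists C.
have [g [cg gL gA Dg]] := c1_extension (@complete_has_cauchy_limits R Y) hC hOmega hA
  (ex_intro _ a0 Aa0) hLE hLA1 hLA1' L0 fL hW hG.
have C2 : 1 <= C ^+ 2 by rewrite exprn_ege1.
have l0 : 0 <= (10 * C ^+ 2 + 1) * L.
  by apply: mulr_ge0 => //; lra.
(* With [eta = L / 4] the smoothing costs exactly [L], and the total is [(10 C^2 + 2) L]. *)
have eta0 : 0 < L / 4 by rewrite divr_gt0.
have final k' : k' <> Some 0%N -> property_LA X Y k' -> exists h : X -> Y,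
    [/\ forall x, A x -> h x = f x,
        (17 * C ^+ 3 * L).-lipschitz_Omega h, Csmooth (Some 1%N) Omega h,
        forall x, A x -> frechet h x = G x & Csmooth k' (Omega `\` A) h].
  move=> k0 hLAk'; have [C3 hLAk''] := @LA_scalar _ _ Y _ _ y00 hLAk'.
  have [C4 hLAk4] := hLAk'.
  have [h [hA' hLip ch Dh ck]] :=
    smooth_off k0 hOmega hA hLAk4 hLAk'' l0 eta0 cg gL.
  exists h; split; [| |exact: ch| |exact: ck].
  - by move=> x Ax; rewrite hA'// gA.
  - apply/lip_onP => x y Ox Oy; apply: (le_trans (hLip x y Ox Oy)).
    rewrite ler_wpM2r//.
    have C23 : C ^+ 2 <= C ^+ 3 by rewrite [leRHS]exprS ler_peMl//; lra.
    have : C ^+ 2 * L <= C ^+ 3 * L by rewrite ler_wpM2r.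
    have : 1 * L <= C ^+ 2 * L by rewrite ler_wpM2r.
    have -> : (10 * C ^+ 2 + 1) * L + 4 * (L / 4) = 10 * (C ^+ 2 * L) + 2 * (1 * L) by field.
    rewrite -mulrA.
    set u := C ^+ 2 * L; set v := C ^+ 3 * L; lra.
  - by move=> x Ax; rewrite Dh// Dg.
(* The encoding of [k] admits order 0; there the extension built with order 1 is used, since C^1
   implies continuous. *)
have [k0|k0] := pselect (k = Some 0%N); last exact: final.
have [h [h1 h2 h3 h4 h5]] := @final (Some 1%N) (fun E => ltac:(discriminate E))
  (ex_intro _ C hLA1).
exists h; split; [exact: h1|exact: h2|exact: h3|exact: h4|].
by rewrite k0; exact: (@CfinS _ _ 0 _ _ _ oU h5).
Qed.
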